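(* Let $d,r\ge2$ and $e\ge1$, and let $$\lambda=z\,At_e\,At_{e-1}\cdots At_1\in B(de,e,r),\qquad A=s_rs_{r-1}\cdots s_3.$$ In $B(de,e,r)$, an element $g$ is periodic if and only if $g$ is conjugate to a power of $\lambda$.
   Context: For $d,r\ge 2$, $e\ge1$, the braid group $B(de,e,r)$ of the complex reflection group $G(de,e,r)$ is the group with generators $z$, $t_i$ ($i\in\mathbb{Z}$), $s_3,\ldots,s_r$ and relations: $s_is_j=s_js_i$ for $|i-j|\ge2$; $s_is_{i+1}s_i=s_{i+1}s_is_{i+1}$ for $3\le i\le r-1$; $t_it_{i-1}=t_jt_{j-1}$ for $i,j\in\mathbb{Z}$; $s_3t_is_3=t_is_3t_i$ for $i\in\mathbb{Z}$; $s_jt_i=t_is_j$ for $i\in\mathbb{Z}$, $4\le j\le r$; $zt_i=t_{i-e}z$ for $i\in\mathbb{Z}$; $zs_j=s_jz$ for $3\le j\le r$. If $r=2$ there are no $s_j$ and $A=1$. An element $g$ of a group is periodic if it has a central power, i.e. $g^k$ is central in the group for some nonzero integer $k$. ''Power'' means $\lambda^q$ with $q\in\mathbb{Z}$. *)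

(* Defs.v *)
From HB Require Import structures.
From mathcomp Require Import all_boot all_order all_algebra.
From mathcomp Require Import boolp.

Set Implicit Arguments.
Unset Strict Implicit.
Unset Printing Implicit Defensive.

Import IntDist.
Local Open Scope group_scope.

(* The group with generators X and relations u = v for R u v, where u and v   *)
(* are positive words.  A letter (x, b) stands for x if b = false and for the *)
(* inverse of x if b = true.                                                  *)
Section Presentation.
Variables (X : choiceType) (R : seq X -> seq X -> Prop).

Definition word : Type := seq (X * bool).
HB.instance Definition _ := Choice.on word.

Definition positive (u : seq X) : word := [seq (x, false) | x <- u].
Definition flip (a : X * bool) : X * bool := (a.1, ~~ a.2).
Definition winv (u : word) : word := rev (map flip u).

Inductive word_eq : word -> word -> Prop :=
| WordRefl u : word_eq u u
| WordSym u v : word_eq u v -> word_eq v u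
| WordTrans v u w : word_eq u v -> word_eq v w -> word_eq u w
| WordCat u u' v v' : word_eq u u' -> word_eq v v' -> word_eq (u ++ v) (u' ++ v')
| WordCancel a : word_eq [:: a; flip a] [::]
| WordRel u v : R u v -> word_eq (positive u) (positive v).

Definition word_eqb (u v : word) : bool := `[< word_eq u v >].

Lemma word_eqb_refl : reflexive word_eqb.
Proof. by move=> u; apply/asboolP/WordRefl. Qed.

Lemma word_eqb_sym : symmetric word_eqb.
Proof. by move=> u v; apply/asboolP/asboolP; apply: WordSym. Qed.

Lemma word_eqb_trans : transitive word_eqb.
Proof.
by move=> v u w /asboolP uv /asboolP vw; apply/asboolP/(WordTrans uv vw).
Qed.

Canonical word_equiv :=
  EquivRel word_eqb word_eqb_refl word_eqb_sym word_eqb_trans.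

Definition presented : Type := {eq_quot word_equiv}%qT.
HB.instance Definition _ := Choice.on presented.
HB.instance Definition _ := Quotient.on presented.

Definition class_of (u : word) : presented := (\pi_presented u)%qT.

Lemma class_ofP u v : class_of u = class_of v <-> word_eq u v.
Proof.
split; first by move/eqmodP/asboolP.
by move=> uv; apply/eqmodP/asboolP.
Qed.

Definition pone : presented := class_of [::].
Definition pmul (x y : presented) : presented :=
  class_of (repr x ++ repr y).
Definition pinv (x : presented) : presented := class_of (winv (repr x)).

Lemma class_of_repr (x : presented) : class_of (repr x) = x.
Proof. exact: reprK. Qed.

Lemma repr_class_of u : word_eq (repr (class_of u)) u.
Proof. by apply/class_ofP; rewrite class_of_repr. Qed.

Lemma pmulE u v : pmul (class_of u) (class_of v) = class_of (u ++ v).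
Proof. by apply/class_ofP; apply: WordCat; apply: repr_class_of. Qed.

Lemma flipK : involutive flip.
Proof. by case=> x b; rewrite /flip /= negbK. Qed.

Lemma winv_cons a u : winv (a :: u) = winv u ++ [:: flip a].
Proof. by rewrite /winv /= rev_cons cats1. Qed.

Lemma winvK : involutive winv.
Proof.
move=> u; rewrite /winv map_rev revK -map_comp.
by rewrite (eq_map (g := id)) ?map_id // => a; apply: flipK.
Qed.

Lemma word_catV u : word_eq (u ++ winv u) [::].
Proof.
elim: u => [|a u IHu]; first exact: WordRefl.
rewrite winv_cons -cat1s -catA (catA u).
apply: WordTrans (WordCancel a); rewrite -[[:: a; flip a]]/([:: a] ++ [::] ++ [:: flip a]).
by apply: WordCat; [apply: WordRefl|apply: WordCat => //; apply: WordRefl].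
Qed.

Lemma pmulA : associative pmul.
Proof.
move=> x y z; rewrite -[x]class_of_repr -[y]class_of_repr -[z]class_of_repr.
by rewrite !pmulE catA.
Qed.

Lemma pmul1 : left_id pone pmul.
Proof. by move=> x; rewrite -[x]class_of_repr pmulE. Qed.

Lemma pmulr1 : right_id pone pmul.
Proof. by move=> x; rewrite -[x]class_of_repr pmulE cats0. Qed.

Lemma pmulrV : right_inverse pone pinv pmul.
Proof.
move=> x; rewrite -{1}[x]class_of_repr pmulE.
by apply/class_ofP/word_catV.
Qed.

Lemma pmulVr : left_inverse pone pinv pmul.
Proof.
move=> x; rewrite -{2}[x]class_of_repr pmulE.
by apply/class_ofP; rewrite -{2}[repr x]winvK; apply: word_catV.
Qed.

HB.instance Definition _ :=
  isGroup.Build presented pmulA pmul1 pmulr1 pmulVr pmulrV.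

Definition pgen (x : X) : presented := class_of [:: (x, false)].

End Presentation.

Section GroupNotions.
Variable G : groupType.

Definition expgz (x : G) (k : int) : G :=
  match k with Posz n => x ^+ n | Negz n => x ^- n.+1 end.

Definition central (x : G) : Prop := forall y : G, commute x y.

Definition periodic (x : G) : Prop :=
  exists k : int, k != 0%R /\ central (expgz x k).

Definition conjugate (x y : G) : Prop := exists h : G, x = y ^ h.

End GroupNotions.

(* The index j : 'I_(r - 2) of GenS j is shifted by 3: GenS j is the          *)
(* generator s_(3 + j), so that its label ranges over 3, ..., r.              *)
Inductive braid_gen (r : nat) : Type :=
| GenZ
| GenT of int
| GenS of 'I_(r - 2).
Arguments GenZ {r}.
Arguments GenT {r}.

Section BraidGenChoice.
Variable r : nat.

Definition braid_gen_enc (x : braid_gen r) : option (int + 'I_(r - 2)) :=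
  match x with
  | GenZ => None
  | GenT i => Some (inl i)
  | GenS j => Some (inr j)
  end.

Definition braid_gen_dec (x : option (int + 'I_(r - 2))) : braid_gen r :=
  match x with
  | None => GenZ
  | Some (inl i) => GenT i
  | Some (inr j) => GenS j
  end.

Lemma braid_gen_encK : cancel braid_gen_enc braid_gen_dec.
Proof. by case. Qed.

HB.instance Definition _ := Countable.copy (braid_gen r) (can_type braid_gen_encK).

End BraidGenChoice.

Definition label (r : nat) (j : 'I_(r - 2)) : nat := (3 + j)%N.

Inductive braid_rel (e r : nat) : seq (braid_gen r) -> seq (braid_gen r) -> Prop :=
| RelSS i j : (2 <= `|label i - label j|)%N ->
    braid_rel e [:: GenS i; GenS j] [:: GenS j; GenS i]
| RelSSS i j : label j = (label i).+1 ->
    braid_rel e [:: GenS i; GenS j; GenS i] [:: GenS j; GenS i; GenS j]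
| RelTT (i j : int) :
    braid_rel e [:: GenT i; GenT (i - 1)%R] [:: GenT j; GenT (j - 1)%R]
| RelSTS (i : int) j : label j = 3 ->
    braid_rel e [:: GenS j; GenT i; GenS j] [:: GenT i; GenS j; GenT i]
| RelST (i : int) j : (4 <= label j)%N ->
    braid_rel e [:: GenS j; GenT i] [:: GenT i; GenS j]
| RelZT (i : int) :
    braid_rel e [:: GenZ; GenT i] [:: GenT (i - e%:Z)%R; GenZ]
| RelZS j :
    braid_rel e [:: GenZ; GenS j] [:: GenS j; GenZ].

(* The braid group B(de, e, r); its presentation does not involve d.          *)
Definition B (d e r : nat) : groupType := presented (@braid_rel e r).

Section BraidElements.
Variables d e r : nat.

Definition braid_z : B d e r := pgen (@braid_rel e r) GenZ.
Definition braid_t (i : int) : B d e r := pgen (@braid_rel e r) (GenT i).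
Definition braid_s (j : 'I_(r - 2)) : B d e r := pgen (@braid_rel e r) (GenS j).

(* s_r s_(r-1) ... s_3: the label of rev_ord k is r - k. *)
Definition braid_A : B d e r := \prod_(k < r - 2) braid_s (rev_ord k).

Definition braid_lambda : B d e r :=
  braid_z * \prod_(k < e) (braid_A * braid_t (e%:Z - k%:Z)%R).

End BraidElements.

(* Main.v *)
From HB Require Import structures.
From Stdlib Require Import Setoid Morphisms.
Require Import Defs.
From mathcomp Require Import all_boot all_order all_algebra.
From mathcomp Require Import boolp.
From mathcomp Require Import zify ring.

(* Let c be the Coxeter element of the dual braid monoid of type B_r and Gamma *)
(* its group of fractions.  Left divisibility is a lattice order on Gamma,     *)
(* invariant under left translations and under conjugation by c.  If           *)
(* g ^ n = c ^ (m n) is central, then x |-> g x c ^ -m is an order             *)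
(* automorphism of finite order, so the least upper bound X of the orbit of 1  *)
(* is a fixed point: g X = X c ^ m.  Hence every root of a central power of c  *)
(* is conjugate to a power of c.                                               *)
(*                                                                             *)
(* The group Gamma is B(d, 1, r), and B(de, e, r) maps to it with z going to   *)
(* the e-th power of a generator and lambda to c ^ e.  An element of Gamma     *)
(* commuting with all arcs is a power of c, so that a central power of g is    *)
(* determined by its winding number and some power of g is a power of lambda.  *)
(* The conjugating element is brought back from Gamma through a homomorphism   *)
(* from Gamma to an extension of B(de, e, r) by Z.                             *)
(*                                                                             *)
(* The lattice property comes from Garside's lemma for complemented            *)
(* presentations.  Its cube condition involves three atoms, hence at most six  *)
(* of the r points of the circle, and is checked by computation for r <= 6.    *)

Set Implicit Arguments.
Unset Strict Implicit.
Unset Printing Implicit Defensive.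

Local Open Scope group_scope.

(** * Complemented presentations *)

(** With n = r - 1, the group [dual n] is the annular braid group on r strands, and conjugation by
    its Coxeter element [cox n] rotates the circle by one step. The map [to_dual] sends lambda to
    [cox n ^+ e]; the map [from_dual] leads back to an extension of B(de, e, r) by Z, on which the
    degree [ext_deg] counts winding.

    Since [cox n ^+ r] is central and [to_dual] is injective, lambda ^ r is central, so conjugates
    of powers of lambda are periodic. Conversely, by [from_to_dual] the image of any g has degree e
    m for some m, so lambda ^ m is the only power to which g can be conjugate. If g is periodic,
    suitable equal powers of g and of lambda ^ m are central and differ by a central element of
    degree 0, which has trivial image ([to_dual_central_deg0], from [dual_center]). The two images
    are then roots of one central element, and the fixed point of [root_conjugate] conjugates one to
    the other. A power of [cox n] commutes with the image of lambda ^ m, so it can be used to bring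
    the conjugating element to degree 0; [from_dual] then sends that element into the copy of B(de,
    e, r), where the conjugacy is read off.

    The fixed point is a least upper bound, provided by [left_divides_lub]; this rests on
    [garside_lemma] and on the cube condition [complement_cube]. *)

Section ComplementedMonoid.
Variables (S : choiceType) (C : S -> S -> seq S).

Inductive rewrite_step : seq S -> seq S -> Prop :=
  Step l a b r : rewrite_step (l ++ a :: C a b ++ r) (l ++ b :: C b a ++ r).

Inductive meq : seq S -> seq S -> Prop :=
| MeqRefl u : meq u u
| MeqStep u v w : rewrite_step u v -> meq v w -> meq u w.

#[local] Hint Resolve MeqRefl : core.

Lemma step_meq u v : rewrite_step u v -> meq u v.
Proof. by move=> uv; apply: MeqStep uv (MeqRefl _). Qed.

Lemma meq_trans u v w : meq u v -> meq v w -> meq u w.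
Proof. by elim=> // {}u v' w' uv _ IH /IH; apply: MeqStep. Qed.

Lemma step_sym u v : rewrite_step u v -> rewrite_step v u.
Proof. by case=> l a b r; apply: Step. Qed.

Lemma meq_sym u v : meq u v -> meq v u.
Proof.
elim=> [?|{}u v' w uv _ IH]; first exact: MeqRefl.
exact: meq_trans IH (step_meq (step_sym uv)).
Qed.

Lemma meq_catl x u v : meq u v -> meq (x ++ u) (x ++ v).
Proof.
elim=> [?|{}u v' w [l a b r] _ IH]; first exact: MeqRefl.
by apply: MeqStep IH; rewrite !(catA x); apply: Step.
Qed.

Lemma meq_catr x u v : meq u v -> meq (u ++ x) (v ++ x).
Proof.
elim=> [?|{}u v' w [l a b r] _ IH]; first exact: MeqRefl.
by apply: MeqStep IH; rewrite -!catA /= -!catA; apply: Step.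
Qed.

Lemma meq_cat u u' v v' : meq u u' -> meq v v' -> meq (u ++ v) (u' ++ v').
Proof. by move=> uu' vv'; apply: meq_trans (meq_catr _ uu') (meq_catl _ vv'). Qed.

#[local] Instance meq_equivalence : Equivalence meq.
Proof. by split; [exact: MeqRefl | exact: meq_sym | exact: meq_trans]. Qed.

#[local] Instance meq_cat_proper : Proper (meq ==> meq ==> meq) (@cat S).
Proof. by move=> u u' uu' v v'; apply: meq_cat. Qed.

#[local] Instance meq_cons_proper a : Proper (meq ==> meq) (@cons S a).
Proof. by move=> u v /(meq_catl [:: a]). Qed.

Lemma meq_rel a b r : meq (a :: C a b ++ r) (b :: C b a ++ r).
Proof. exact/step_meq/(Step [::]). Qed.

(** Word reversing of u^-1 v into p q^-1, filled in as a grid. It is a relation because reversing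
    need not terminate for an arbitrary [C]. *)
Inductive reverses : seq S -> seq S -> seq S -> seq S -> Prop :=
| RevNill v : reverses [::] v v [::]
| RevNilr u : reverses u [::] [::] u
| RevCons a b u v p1 q1 p2 q2 p3 q3 :
    reverses u (C a b) p1 q1 -> reverses (C b a) v p2 q2 ->
      reverses q1 p2 p3 q3 ->
    reverses (a :: u) (b :: v) (p1 ++ p3) (q2 ++ q3).

Lemma reverses_sound u v p q : reverses u v p q -> meq (u ++ p) (v ++ q).
Proof.
elim=> [?|?|a b {}u {}v p1 q1 p2 q2 p3 q3 _ IH1 _ IH2 _ IH3] /=.
- by rewrite cats0; apply: MeqRefl.
- by rewrite cats0; apply: MeqRefl.
- rewrite !catA IH1 -(catA _ q1) IH3 -IH2 -!catA.
  exact: meq_rel.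
Qed.

(** The common multiple of [a], [b] and [d] found by reversing below [d] is a multiple of the lcm of
    [a] and [b], with the same quotient [s] on both sides. *)
Definition cube a b d := exists p q s,
  [/\ reverses (C d a) (C d b) p q, meq (C a d ++ p) (C a b ++ s)
    & meq (C b d ++ q) (C b a ++ s)].

Hypothesis Caa : forall a, C a a = [::].
Hypothesis Csize : forall a b, size (C a b) = size (C b a).
Hypothesis Ccube : forall a b d, cube a b d.

Lemma meq_size u v : meq u v -> size u = size v.
Proof.
elim=> // {}u v' w [l a b r] _ <-.
by rewrite !size_cat /= !size_cat (Csize a b).
Qed.

Lemma step_cons a u z : rewrite_step (a :: u) z ->
  (exists d r, u = C a d ++ r /\ z = d :: C d a ++ r) \/
  (exists2 u', z = a :: u' & rewrite_step u u').
Proof.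
move E: (a :: u) => x s; case: s E => l a1 b r; case: l => [|a' l].
- by case=> -> ->; left; exists b, r.
- by move=> /= [-> ->]; right; exists (l ++ b :: C b a1 ++ r).
Qed.

Definition garside_upto n := forall a b u v, size u < n ->
  meq (a :: u) (b :: v) ->
  exists w, meq u (C a b ++ w) /\ meq v (C b a ++ w).

(** A common multiple factors through each square of the reversing grid in turn; the length bound
    keeps every square within reach of [garside_upto n]. *)
Lemma reverses_lcm_upto n : garside_upto n -> forall u v p q, reverses u v p q ->
  forall x y, size (u ++ x) <= n -> meq (u ++ x) (v ++ y) ->
  exists w, meq x (p ++ w) /\ meq y (q ++ w).
Proof.
move=> Gn u v p q; elim=> [{}v|{}u|a b {}u {}v p1 q1 p2 q2 p3 q3 r1 IH1 r2 IH2
  r3 IH3] x y /=.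
- by move=> _ xv; exists y.
- by move=> _ xv; exists x; split=> //; apply: meq_sym.
move=> sz uv; have szv := meq_size uv.
case: (Gn _ _ _ _ sz uv) => w [uw vw].
have szu := meq_size uw; have szw := meq_size vw.
case: (IH1 x w _ uw) => [|x1 [xx1 wx1]]; first exact: ltnW.
have sz2 : size (C b a ++ w) <= n.
  by rewrite size_cat -Csize -size_cat -szu ltnW.
case: (IH2 w y sz2 (meq_sym vw)) => y1 [wy1 yy1].
have sz3 : size (q1 ++ x1) <= n.
  rewrite -(meq_size wx1); apply: leq_trans sz2; rewrite size_cat;
    exact: leq_addl.
case: (IH3 x1 y1 sz3 (meq_trans (meq_sym wx1) wy1)) => z [xz yz].
exists z; rewrite -!catA; split.
- exact: meq_trans xx1 (meq_catl _ xz).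
- exact: meq_trans yy1 (meq_catl _ yz).
Qed.

(** Induction on the length and then on the derivation. Only a step that replaces the first letter
    [a] by some [d] matters: the derivation from [d] on gives the lcm of [d] and [b], and the cube
    condition for [a], [b], [d] transfers this to [a] and [b]. *)
Lemma garside_lemma n : garside_upto n.
Proof.
elim: n => // n IHn a b u v szu; move E: (a :: u) => x; move E': (b :: v) => y xy.
elim: xy a u szu E E' => [{}x|{}x z {}y xz zy IH] a u szu Ex Ey; last first.
  move: xz; rewrite -Ex => /step_cons[[d [r [Eu Ez]]]|[u' Ez uu']].
  - have szr : size (C d a ++ r) < n.+1.
      by move: szu; rewrite Eu !size_cat Csize.
    case: (IH d _ szr (esym Ez) Ey) => w [rw vw].
    case: (Ccube a b d) => p [q [s [rpq eqa eqb]]].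
    (* The tails after [d] are one letter shorter, so the outer induction factors them through the
       reversing of [C d a] and [C d b]. *)
    case: (reverses_lcm_upto IHn rpq _ rw) => // t [rt wt].
    exists (s ++ t); rewrite Eu; split; rewrite catA.
    + by rewrite -eqa -catA -rt.
    + by rewrite -eqb -catA -wt.
  - have szu' : size u' < n.+1 by rewrite -(meq_size (step_meq uu')).
    case: (IH a u' szu' (esym Ez) Ey) => w [uw vw].
    by exists w; split=> //; apply: MeqStep uw.
by move: Ey; rewrite -Ex => -[-> ->]; exists u; rewrite Caa.
Qed.

Lemma meq_lcm a b u v : meq (a :: u) (b :: v) ->
  exists w, meq u (C a b ++ w) /\ meq v (C b a ++ w).
Proof. by move=> uv; apply: (garside_lemma (n := (size u).+1)) uv. Qed.

Lemma meq_consI a u v : meq (a :: u) (a :: v) -> meq u v.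
Proof. by case/meq_lcm=> w; rewrite Caa => -[uw vw]; rewrite uw vw. Qed.

Lemma meq_catI x u v : meq (x ++ u) (x ++ v) -> meq u v.
Proof. by elim: x => //= a x IHx /meq_consI. Qed.

Definition is_lcm u v p q := meq (u ++ p) (v ++ q) /\
  forall x y, meq (u ++ x) (v ++ y) -> exists w, meq x (p ++ w) /\ meq y (q ++ w).

(** The known common multiple bounds the reversing grid, so induction on its length replaces a
    termination argument. *)
Lemma lcm_exists u v x y : meq (u ++ x) (v ++ y) -> exists p q, is_lcm u v p q.
Proof.
have [n] := ubnP (size (u ++ x)); elim: n => // n IHn in u v x y *.
case: u => [_ _|a u]; first by exists v, [::]; split=> [|x' y' /= E];
  [rewrite cats0|exists y'].
case: v => [_ _|b v].
  by exists [::], (a :: u); split=> [|x' y' /= E]; [rewrite cats0|exists x';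
    split=> //; rewrite E].
rewrite ltnS !cat_cons => szn uv; case: (meq_lcm uv) => w [uw vw].
have szu := meq_size uw; have szv := meq_size vw; have sz := meq_size uv.
rewrite /= !size_cat in szn szu szv sz.
have Cab := Csize a b.
case: (IHn u (C a b) x w) => [||p1 [q1 [E1 U1]]]; first by rewrite size_cat; lia.
  exact: uw.
case: (U1 _ _ uw) => w1 [xw1 ww1].
case: (IHn (C b a) v w y) => [||p2 [q2 [E2 U2]]].
- by rewrite size_cat; lia.
- by rewrite vw.
case: (U2 w y) => [|w2 [ww2 yw2]]; first by rewrite vw.
case: (IHn q1 p2 w1 w2) => [||p3 [q3 [E3 U3]]].
- by rewrite -(meq_size ww1); lia.
- by rewrite -ww1.
exists (p1 ++ p3), (q2 ++ q3); split=> [|x' y' xy'].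
- rewrite /= !catA E1 -(catA _ q1) E3 -E2 -!catA.
  exact: meq_rel.
- move: xy'; rewrite !cat_cons => xy'; case: (meq_lcm xy') => z [uz vz].
  case: (U1 _ _ uz) => z1 [xz1 zz1].
  case: (U2 z y') => [|z2 [zz2 yz2]]; first by rewrite vz.
  case: (U3 z1 z2) => [|t [z1t z2t]]; first by rewrite -zz1.
  by exists t; rewrite -!catA -z1t -z2t.
Qed.

End ComplementedMonoid.

(** * The monoid presented by a complement *)

Section QuotientMonoid.
Variables (S : choiceType) (C : S -> S -> seq S).

Definition meqb (u v : seq S) : bool := `[< meq C u v >].

Lemma meqb_refl : reflexive meqb.
Proof. by move=> u; apply/asboolP/MeqRefl. Qed.

Lemma meqb_sym : symmetric meqb.
Proof. by move=> u v; apply/asboolP/asboolP; apply: meq_sym. Qed.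

Lemma meqb_trans : transitive meqb.
Proof. by move=> v u w /asboolP uv /asboolP; move/(meq_trans uv)/asboolP. Qed.

Canonical meq_equiv := EquivRel meqb meqb_refl meqb_sym meqb_trans.

Definition cmonoid : Type := {eq_quot meq_equiv}%qT.
HB.instance Definition _ := Choice.on cmonoid.
HB.instance Definition _ := Quotient.on cmonoid.

Definition mcl (u : seq S) : cmonoid := (\pi_cmonoid u)%qT.

Lemma mclP u v : mcl u = mcl v <-> meq C u v.
Proof.
split; first by move/eqmodP/asboolP.
by move=> uv; apply/eqmodP/asboolP.
Qed.

Lemma mcl_repr (x : cmonoid) : mcl (repr x) = x.
Proof. exact: reprK. Qed.

Definition cmul (x y : cmonoid) := mcl (repr x ++ repr y).

Lemma cmulE u v : cmul (mcl u) (mcl v) = mcl (u ++ v).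
Proof. by apply/mclP/meq_cat; apply/mclP; rewrite mcl_repr. Qed.

Lemma cmulA : associative cmul.
Proof.
by move=> x y z; rewrite -[x]mcl_repr -[y]mcl_repr -[z]mcl_repr !cmulE catA.
Qed.

Lemma cmul1 : left_id (mcl [::]) cmul.
Proof. by move=> x; rewrite -[x]mcl_repr cmulE. Qed.

Lemma cmulr1 : right_id (mcl [::]) cmul.
Proof. by move=> x; rewrite -[x]mcl_repr cmulE cats0. Qed.

HB.instance Definition _ := isMonoid.Build cmonoid cmulA cmul1 cmulr1.

Definition mgen (a : S) : cmonoid := mcl [:: a].

Lemma mcl_cat u v : mcl (u ++ v) = mcl u * mcl v.
Proof. by rewrite -cmulE. Qed.

Lemma mcl_prod u : mcl u = \prod_(a <- u) mgen a.
Proof.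
elim: u => [|a u IHu]; first by rewrite big_nil.
by rewrite big_cons -IHu -mcl_cat.
Qed.

Lemma mgen_rel a b :
  mgen a * \prod_(x <- C a b) mgen x = mgen b * \prod_(x <- C b a) mgen x.
Proof.
rewrite -!mcl_prod -!mcl_cat; apply/mclP.
by have := meq_rel C a b [::]; rewrite !cats0.
Qed.

End QuotientMonoid.

(** * Universal property of a group presentation *)

Section Lift.
Variables (X : choiceType) (R : seq X -> seq X -> Prop) (K : groupType).
Variable phi : X -> K.
Hypothesis phiR : forall u v, R u v ->
  \prod_(x <- u) phi x = \prod_(x <- v) phi x.

Definition eval_letter (a : X * bool) : K :=
  if a.2 then (phi a.1)^-1 else phi a.1.

Lemma eval_word_eq u v : word_eq R u v ->
  \prod_(a <- u) eval_letter a = \prod_(a <- v) eval_letter a.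
Proof.
elim=> //.
- by move=> {}v {}u w _ -> _ ->.
- by move=> {}u u' {}v v' _ E _ E'; rewrite !big_cat /= E E'.
- move=> [x []]; rewrite !big_cons !big_nil /eval_letter /= mulg1.
    exact: mulVg.
  exact: mulgV.
- by move=> {}u {}v /phiR; rewrite !big_map.
Qed.

(* The dummy dependence on phiR lets the morphism instance be inferred. *)
Definition presented_lift (x : presented R) : K :=
  let _ := phiR in \prod_(a <- repr x) eval_letter a.

Lemma presented_lift_class u : presented_lift (class_of R u) =
  \prod_(a <- u) eval_letter a.
Proof. exact/eval_word_eq/repr_class_of. Qed.

Lemma presented_liftM : {morph presented_lift : x y / x * y}.
Proof.
move=> x y; rewrite -[x in LHS]class_of_repr -[y in LHS]class_of_repr.
by rewrite [_ * _]pmulE presented_lift_class big_cat.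
Qed.

Lemma presented_lift1 : presented_lift 1 = 1.
Proof. by rewrite presented_lift_class big_nil. Qed.

HB.instance Definition _ :=
  isUMagmaMorphism.Build (presented R) K presented_lift (presented_lift1,
    presented_liftM).

Lemma presented_lift_pgen x : presented_lift (pgen R x) = phi x.
Proof. by rewrite presented_lift_class big_seq1. Qed.

End Lift.

Lemma pgen_rel (X : choiceType) (R : seq X -> seq X -> Prop) u v :
  R u v -> \prod_(x <- u) pgen R x = \prod_(x <- v) pgen R x.
Proof.
have E w : \prod_(x <- w) pgen R x = class_of R (positive w).
  elim: w => [|x w IHw]; first by rewrite big_nil.
  by rewrite big_cons IHw [_ * _]pmulE.
by move=> uv; rewrite !E; apply/class_ofP/WordRel.
Qed.

Lemma presented_ind (X : choiceType) (R : seq X -> seq X -> Prop)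
    (P : presented R -> Prop) :
  P 1 -> (forall x, P (pgen R x)) -> (forall x y, P x -> P y -> P (x * y)) ->
  (forall x, P x -> P x^-1) -> forall x, P x.
Proof.
move=> P1 Pg PM PV x; rewrite -[x]class_of_repr.
elim: (repr x) => // -[a b] u IHu.
rewrite -[class_of R _](pmulE R [:: (a, b)] u); apply: PM => //.
case: b; last exact: Pg.
rewrite -[class_of R _](_ : (pgen R a)^-1 = _); last first.
  apply: mulg1_eq; rewrite [_ * _]pmulE.
  by apply/class_ofP; apply: (WordCancel R (a, false)).
exact: PV.
Qed.

(** * Groups of fractions and conjugacy of roots *)

Section ComplementedGroup.
Variables (S : choiceType) (C : S -> S -> seq S).

Definition crel (u v : seq S) := exists a b, u = a :: C a b /\ v = b :: C b a.
Definition cgroup : groupType := presented crel.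
Definition cgen (a : S) : cgroup := pgen crel a.
Definition pos (u : seq S) : cgroup := \prod_(a <- u) cgen a.

Lemma cgen_rel a b :
  cgen a * \prod_(x <- C a b) cgen x = cgen b * \prod_(x <- C b a) cgen x.
Proof.
have E : crel (a :: C a b) (b :: C b a) by exists a, b.
by have := pgen_rel E; rewrite !big_cons.
Qed.

Lemma pos_cat u v : pos (u ++ v) = pos u * pos v.
Proof. exact: big_cat. Qed.

Lemma pos_class u : pos u = class_of crel (positive u).
Proof.
elim: u => [|a u IHu]; first by rewrite /pos big_nil.
by rewrite /pos big_cons -/(pos u) IHu [_ * _]pmulE.
Qed.

Lemma pos_meq u v : meq C u v -> pos u = pos v.
Proof.
elim=> // {}u {}v w [l a b r] _ <-.
by rewrite !pos_cat -!cat_cons !pos_cat /pos !big_cons cgen_rel.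
Qed.

Definition left_divides x y := exists u, y = x * pos u.

Lemma left_divides_refl x : left_divides x x.
Proof. by exists [::]; rewrite /pos big_nil mulg1. Qed.

Lemma left_divides_trans y x z : left_divides x y -> left_divides y z ->
  left_divides x z.
Proof. by move=> [u ->] [v ->]; exists (u ++ v); rewrite pos_cat mulgA. Qed.

Hypothesis Caa : forall a, C a a = [::].
Hypothesis Csize : forall a b, size (C a b) = size (C b a).
Hypothesis Ccube : forall a b d, cube C a b d.

Lemma mcl_mulI u (x y : cmonoid C) : mcl C u * x = mcl C u * y -> x = y.
Proof.
rewrite -[x]mcl_repr -[y]mcl_repr -!mcl_cat => /mclP uxy.
by apply/mclP/(meq_catI Caa Csize Ccube uxy).
Qed.

Variables (Delta : seq S) (star : S -> seq S).
Hypothesis DeltaC : forall a, commute (mcl C Delta) (mgen C a).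
Hypothesis starP : forall a, mgen C a * mcl C (star a) = mcl C Delta.

Local Notation D := (mcl C Delta).

Lemma Delta_central (x : cmonoid C) : commute D x.
Proof.
rewrite -[x]mcl_repr [mcl C (repr x)]mcl_prod; elim: (repr x) => [|a u IHu].
  by rewrite big_nil; apply: commute1.
by rewrite big_cons; apply: commuteM.
Qed.

Lemma DeltaXC n (x : cmonoid C) : commute (D ^+ n) x.
Proof. by apply/commute_sym/commuteX/commute_sym/Delta_central. Qed.

Lemma DeltaX_CA n (x y : cmonoid C) : D ^+ n * (x * y) = x * (D ^+ n * y).
Proof. by rewrite !mulgA (DeltaXC n x). Qed.

Lemma DeltaX_mulI n (x y : cmonoid C) : D ^+ n * x = D ^+ n * y -> x = y.
Proof.
elim: n => [|n IHn]; first by rewrite !mul1g.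
by rewrite expgS -!mulgA => /mcl_mulI/IHn.
Qed.

Lemma starPl a : mcl C (star a) * mgen C a = D.
Proof.
apply: (@mcl_mulI [:: a]); rewrite -/(mgen C a) mulgA starP.
exact: DeltaC.
Qed.

(* A word represents Delta^-(den w) * num w. *)
Definition den (w : word S) := count (fun a => a.2) w.
Definition num (w : word S) : cmonoid C :=
  \prod_(a <- w) if a.2 then mcl C (star a.1) else mgen C a.1.

Lemma den_cat u v : den (u ++ v) = (den u + den v)%N.
Proof. exact: count_cat. Qed.

Lemma num_cat u v : num (u ++ v) = num u * num v.
Proof. exact: big_cat. Qed.

(** Equality of the fractions after clearing denominators. It is transitive because powers of Delta
    are central and cancellable. *)
Lemma num_word_eq u v : word_eq crel u v ->
  D ^+ den v * num u = D ^+ den u * num v.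
Proof.
elim=> //.
- move=> {}v {}u w _ uv _ vw; apply: (@DeltaX_mulI (den v)).
  by rewrite [LHS]DeltaX_CA uv [LHS]DeltaX_CA vw [LHS]DeltaX_CA.
- move=> {}u u' {}v v' _ E _ E'; rewrite !den_cat !num_cat !expgnDr.
  rewrite -!mulgA [X in _ * X]DeltaX_CA E' (mulgA _ (num _)) E -!mulgA.
  by congr (_ * _); rewrite DeltaX_CA.
- move=> [a []]; rewrite /den /num !big_cons !big_nil /= !mulg1 ?mul1g.
    by rewrite starPl.
  by rewrite starP.
- move=> _ _ [a [b [-> ->]]].
  have d0 w : den (positive w) = 0 by elim: w.
  have nE w : num (positive w) = \prod_(a <- w) mgen C a.
    by rewrite /num big_map.
  by rewrite !d0 !nE !mul1g !big_cons mgen_rel.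
Qed.

(** The monoid embeds in its group: positive words have denominator 0, so equal fractions have equal
    numerators. *)
Lemma pos_inj u v : pos u = pos v -> meq C u v.
Proof.
rewrite !pos_class => /class_ofP/num_word_eq.
have d0 w : den (positive w) = 0 by elim: w.
have nE w : num (positive w) = mcl C w by rewrite /num big_map -mcl_prod.
by rewrite !d0 !nE !mul1g => /mclP.
Qed.

Lemma left_divides_anti x y : left_divides x y -> left_divides y x -> x = y.
Proof.
move=> [u ->] [v]; rewrite -mulgA -pos_cat => E.
have /pos_inj/(meq_size Csize) : pos [::] = pos (u ++ v).
  by apply: (mulgI x); rewrite -E /pos big_nil mulg1.
by rewrite size_cat; case: u {E} => //= _; rewrite /pos big_nil mulg1.
Qed.

Lemma pos_Delta_central x : commute (pos Delta) x.
Proof.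
elim/presented_ind: x => [|a|x y|x];
  [exact: commute1| |exact: commuteM|exact: commuteV].
have /mclP/pos_meq : mcl C (Delta ++ [:: a]) = mcl C ([:: a] ++ Delta).
  by rewrite !mcl_cat; apply: DeltaC.
by rewrite !pos_cat /commute /pos !big_seq1.
Qed.

Lemma commute_DeltaX n x : commute x (pos Delta ^+ n).
Proof. exact/commuteX/commute_sym/pos_Delta_central. Qed.

Lemma pos_DeltaX n : exists u, pos u = pos Delta ^+ n.
Proof.
elim: n => [|n [u IHn]]; first by exists [::]; rewrite /pos big_nil.
by exists (Delta ++ u); rewrite pos_cat IHn expgS.
Qed.

Lemma pos_divides_DeltaX u : exists v, pos u * pos v = pos Delta ^+ size u.
Proof.
elim: u => [|a u [v IHu]]; first by exists [::]; rewrite /pos big_nil mulg1.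
exists (v ++ star a); rewrite pos_cat {1}/pos big_cons -/(pos u).
have sA : cgen a * pos (star a) = pos Delta.
  have /mclP/pos_meq : mcl C ([:: a] ++ star a) = D by rewrite mcl_cat starP.
  by rewrite pos_cat /pos big_seq1.
by rewrite -mulgA (mulgA (pos u)) IHu mulgA commute_DeltaX -mulgA sA -expgSr.
Qed.

Lemma pos_fraction x : exists n u, pos Delta ^+ n * x = pos u.
Proof.
elim/presented_ind: x => [|a|x y [k [u xu]] [l [v yv]]|x [k [u xu]]].
- by exists 0, [::]; rewrite /pos big_nil mulg1.
- by exists 0, [:: a]; rewrite /pos big_seq1 mul1g.
- exists (k + l)%N, (u ++ v); rewrite pos_cat -xu -yv expgnDr !mulgA.
  by congr (_ * _); rewrite -!mulgA (commute_DeltaX l x).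
- have [v uv] := pos_divides_DeltaX u; have [w wk] := pos_DeltaX k.
  exists (size u), (v ++ w).
  rewrite pos_cat wk -(commute_DeltaX _ x^-1) -uv -xu -(commute_DeltaX k x).
  by rewrite !mulgA mulVg mul1g commute_DeltaX.
Qed.

(** A power of Delta makes both elements positive. Positive elements divide powers of Delta, hence
    have a common multiple, and [lcm_exists] applies. *)
Lemma left_divides_lub x y : exists z,
  [/\ left_divides x z, left_divides y z & forall t, left_divides x t ->
    left_divides y t -> left_divides z t].
Proof.
have [k [u xu]] := pos_fraction x; have [l [v yv]] := pos_fraction y.
have [kw kE] := pos_DeltaX k; have [lw lE] := pos_DeltaX l.
pose d := pos Delta ^+ (k + l).
have {xu}xu : d * x = pos (lw ++ u).
  by rewrite pos_cat lE -xu /d addnC expgnDr mulgA.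
have {yv}yv : d * y = pos (kw ++ v) by rewrite pos_cat kE -yv /d expgnDr mulgA.
move: (lw ++ u) (kw ++ v) xu yv => {kw lw kE lE}{}u {}v xu yv.
have [u' uE] := pos_divides_DeltaX u; have [v' vE] := pos_divides_DeltaX v.
have [uw uwE] := pos_DeltaX (size u); have [vw vwE] := pos_DeltaX (size v).
have uv : meq C (u ++ (u' ++ vw)) (v ++ (v' ++ uw)).
  apply: pos_inj; rewrite !pos_cat !mulgA uE vE uwE vwE.
  exact: commute_DeltaX.
have [p [q [/pos_meq pq lub]]] := lcm_exists Caa Csize Ccube uv.
have xz : left_divides x (x * pos p) by exists p.
exists (x * pos p); split=> //.
- exists q; apply: (mulgI d); rewrite !mulgA xu yv -!pos_cat //.
- move=> t [a xa] [b yb].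
  have /lub[w [aw _]] : meq C (u ++ a) (v ++ b).
    by apply: pos_inj; rewrite !pos_cat -xu -yv -!mulgA -xa -yb.
  by exists w; rewrite xa (pos_meq aw) pos_cat mulgA.
Qed.

(* The least upper bound X of the orbit of 1 under the order-preserving map    *)
(* x |-> g * x / k satisfies X <= g * X / k <= ... <= g ^+ n * X / k ^+ n = X. *)
Theorem root_conjugate n (g k : cgroup) : 0 < n ->
  (forall a, exists u, cgen a ^ k^-1 = pos u) ->
  (forall x, commute (k ^+ n) x) -> g ^+ n = k ^+ n ->
  exists x, g = k ^ x.
Proof.
move=> n_gt0 kpos kC gk; pose T x := g * x / k.
have kP u : exists v, pos u ^ k^-1 = pos v.
  elim: u => [|a u [v IHu]]; first by exists [::]; rewrite /pos big_nil conj1g.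
  have [w aw] := kpos a; exists (w ++ v).
  by rewrite pos_cat -aw -IHu -conjMg /pos big_cons.
have Tmono x y : left_divides x y -> left_divides (T x) (T y).
  move=> [u ->]; have [v kv] := kP u; exists v.
  by rewrite -kv /T conjgE invgK !mulgA mulgVK.
have TE m x : iter m T x = g ^+ m * x / k ^+ m.
  elim: m => [|m IHm] /=; first by rewrite invg1 mul1g mulg1.
  by rewrite IHm /T !expgS invgM !mulgA.
have Tn x : iter n T x = x by rewrite TE gk kC mulgK.
have [X [ubX lubX]] : exists X, (forall m, m < n ->
  left_divides (iter m T 1) X) /\
    forall Y, (forall m, m < n -> left_divides (iter m T 1) Y) ->
      left_divides X Y.
  have: exists X, (forall m, m < n.-1.+1 -> left_divides (iter m T 1) X) /\
      forall Y, (forall m, m < n.-1.+1 -> left_divides (iter m T 1) Y) ->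
        left_divides X Y.
    elim: n.-1 => [|m [X [ubX lubX]]].
      exists 1; split=> [[] // _|Y]; first exact: left_divides_refl.
      by move/(_ 0 isT).
    have [Z [XZ mZ lubZ]] := left_divides_lub X (iter m.+1 T 1).
    exists Z; split=> [i|Y ubY].
      rewrite ltnS leq_eqVlt => /predU1P[->//|im].
      exact: left_divides_trans (ubX _ im) XZ.
    apply: lubZ; last exact: ubY.
    by apply: lubX => i im; apply: ubY; apply: leqW.
  by rewrite prednK.
have XT : left_divides X (T X).
  apply: lubX => -[_|m mn]; last by apply: Tmono; apply: ubX; apply: ltnW.
  (* The first orbit point 1 is also the image under [T] of the last one. *)
  rewrite -[left_divides _ _]/(left_divides 1 (T X)) -[1](Tn 1) -(prednK n_gt0)
    /=.
  by apply: Tmono; apply: ubX; rewrite prednK.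
have XTm m : left_divides X (iter m T X).
  elim: m => [|m IHm] /=; first exact: left_divides_refl.
  exact: left_divides_trans XT (Tmono _ _ IHm).
have TX : T X = X.
  apply: left_divides_anti => //;
    rewrite -[X in left_divides _ X]Tn -(prednK n_gt0) /=.
  exact/Tmono/XTm.
exists X^-1; rewrite conjgE invgK mulgA; apply: (mulIg X); rewrite mulgVK.
by rewrite -[X in RHS](_ : T X = X) // /T mulgVK.
Qed.

End ComplementedGroup.

(** * The dual braid monoid of type B *)

Section CheckCube.
Variables (S : choiceType) (C : S -> S -> seq S).

Fixpoint reverse_words (fuel : nat) (u v : seq S) : option (seq S * seq S) :=
  if fuel isn't f.+1 then None else
  match u, v with
  | [::], _ => Some (v, [::])
  | _, [::] => Some ([::], u)
  | a :: u', b :: v' =>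
    if reverse_words f u' (C a b) is Some (p1, q1) then
      if reverse_words f (C b a) v' is Some (p2, q2) then
        if reverse_words f q1 p2 is Some (p3, q3) then Some (p1 ++ p3, q2 ++ q3)
        else None
      else None
    else None
  end.

Lemma reverse_wordsP fuel u v p q : reverse_words fuel u v = Some (p, q) ->
  reverses C u v p q.
Proof.
elim: fuel => //= f IHf in u v p q *.
case: u => [|a u]; first by case=> <- <-; apply: RevNill.
case: v => [|b v]; first by case=> <- <-; apply: RevNilr.
case E1: (reverse_words f u _) => [[p1 q1]|//];
  case E2: (reverse_words f _ v) => [[p2 q2]|//].
case E3: (reverse_words f q1 p2) => [[p3 q3]|//] [<- <-].
by apply: RevCons; apply: IHf; [exact: E1|exact: E2|exact: E3].
Qed.

(** An empty second word in a reversing result certifies left divisibility. The last reversing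
    checks that the quotients [s] and [s'] found on the two sides represent the same element. *)
Definition cubeb fuel a b d : bool :=
  if reverse_words fuel (C d a) (C d b) is Some (p, q) then
    if reverse_words fuel (C a b) (C a d ++ p) is Some (s, [::]) then
      if reverse_words fuel (C b a) (C b d ++ q) is Some (s', [::]) then
        if reverse_words fuel s s' is Some ([::], [::]) then true else false
      else false
    else false
  else false.

Lemma cubebP fuel a b d : cubeb fuel a b d -> cube C a b d.
Proof.
rewrite /cubeb; case E: reverse_words => [[p q]|//].
case E1: reverse_words => [[s [|//]]|//];
  case E2: reverse_words => [[s' [|//]]|//].
case E3: reverse_words => [[[|//] [|//]]|//] _; exists p, q, s; split.
- exact: reverse_wordsP E.
- by apply: meq_sym; have := reverses_sound (reverse_wordsP E1); rewrite cats0.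
- have := reverses_sound (reverse_wordsP E3); rewrite !cats0 => ss'.
  apply: meq_trans (meq_catl _ (meq_sym ss')).
  by apply: meq_sym; have := reverses_sound (reverse_wordsP E2); rewrite cats0.
Qed.

End CheckCube.

Section MapCube.
Variables (S S' : choiceType) (C : S -> S -> seq S) (C' : S' -> S' -> seq S').
Variable f : S -> S'.
Hypothesis fC : forall a b, C' (f a) (f b) = map f (C a b).

Lemma meq_map u v : meq C u v -> meq C' (map f u) (map f v).
Proof.
elim=> [w|{}u {}v w [l a b r] _ IH]; first exact: MeqRefl.
by apply: MeqStep IH; rewrite !map_cat /= !map_cat -!fC; apply: Step.
Qed.

Lemma reverses_map u v p q : reverses C u v p q ->
  reverses C' (map f u) (map f v) (map f p) (map f q).
Proof.
elim=> [w|w|a b {}u {}v p1 q1 p2 q2 p3 q3 _ IH1 _ IH2 _ IH3] /=.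
- exact: RevNill.
- exact: RevNilr.
- by rewrite !map_cat; apply: RevCons IH3; rewrite fC.
Qed.

Lemma cube_map a b d : cube C a b d -> cube C' (f a) (f b) (f d).
Proof.
move=> [p [q [s [/reverses_map pq /meq_map ps /meq_map qs]]]].
exists (map f p), (map f q), (map f s).
by rewrite !fC -!map_cat.
Qed.

End MapCube.

(* The complement (i, j)^-1 ((i, j) \/ (k, l)) in the dual braid monoid of     *)
(* type B_R, for i <= k < i + R: here (i, j) with i < j <= i + R is the atom   *)
(* attached to the pair of chords {i, j} and {i + R, j + R} of a regular       *)
(* 2R-gon, a diameter if j = i + R.                                            *)
Definition lift_complement (R i j k l : nat) : seq (nat * nat) :=
  if j == i + R then
    if k == i then (if l == i + R then [::] else [:: (k, l)])
    else if l < i + R then [:: (k, l)]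
    else if (l == i + R) || (l == k + R) then [:: (i, k)]
    else [:: (i, l - R); (l - R, k)]
  else if k == i then
    if l == j then [::]
    else if l < j then [:: (k, l)]
    else if l < i + R then [:: (j, l)]
    else [:: (j, j + R)]
  else if k < j then
    if l < j then [:: (k, l)]
    else if l == j then [:: (i, k)]
    else if l < i + R then [:: (i, k); (j, l)]
    else if (l == i + R) || (l == k + R) then [:: (i, k); (j, j + R)]
    else [:: (i, l - R); (l - R, k); (j, j + R)]
  else if k == j then
    if l < i + R then [:: (j, l)]
    else if (l == i + R) || (l == j + R) then [:: (j, j + R)]
    else [:: (i, l - R); (j, j + R)]
  else if l < i + R then [:: (k, l)]
  else if l == i + R then [:: (k, j + R)]
  else if l < j + R then [:: (i + R, l); (k, j + R)]
  else [:: (k, l)].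

Definition lifted (R i j k l : nat) :=
  [/\ i < j <= i + R, i <= k < i + R & k < l <= k + R].

Lemma lift_complement_valid R i j k l : lifted R i j k l ->
  all (fun p => p.1 < p.2 <= p.1 + R) (lift_complement R i j k l).
Proof. by rewrite /lift_complement => -[? ? ?]; do ![case: ifP => /= ?] => //;
  lia. Qed.

(** The formula only compares points and shifts them by the period, so it commutes with increasing
    maps compatible with the periods. This is what makes the cube condition a question about few
    points. *)
Lemma lift_complement_map R R' (psi : nat -> nat) i j k l :
  {homo psi : x y / x < y} -> (forall x, psi (x + R) = psi x + R') ->
  lifted R i j k l ->
  lift_complement R' (psi i) (psi j) (psi k) (psi l) =
  [seq (psi p.1, psi p.2) | p <- lift_complement R i j k l].
Proof.
move=> psi_lt psiR ijkl.
have psi_le : {mono psi : x y / x <= y} := leq_mono psi_lt.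
have psi_ltE : {mono psi : x y / x < y} := leqW_mono psi_le.
have psi_eq x y : (psi x == psi y) = (x == y) by rewrite !eqn_leq !psi_le.
have psiB x : R <= x -> psi x - R' = psi (x - R).
  by move=> Rx; rewrite -{1}(subnK Rx) psiR addnK.
have Rl : i + R <= l -> R <= l by lia.
rewrite /lift_complement -!psiR !psi_ltE !psi_eq.
do ![case: ifP => /= ?] => //; rewrite -?psiR ?psiB //; lia.
Qed.

(* The atom (i, j) modulo simultaneous shifts by n.+1 is encoded by the        *)
(* residue of i and by j - i - 1.                                              *)
Definition atom (n : nat) : Type := ('I_n.+1 * 'I_n.+1)%type.

Section Atoms.
Variable n : nat.
Local Notation R := n.+1.

Definition arc (i j : nat) : atom n := (inZp i, inZp (j - i).-1).
Definition lo (a : atom n) : nat := a.1.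
Definition hi (a : atom n) : nat := (a.1 + a.2).+1.

Definition complement (a b : atom n) : seq (atom n) :=
  let s := if lo b < lo a then R else 0 in
  [seq arc p.1 p.2 | p <- lift_complement R (lo a) (hi a) (lo b + s) (hi b + s)].

Lemma arcP a : [/\ lo a < R, lo a < hi a <= lo a + R & arc (lo a) (hi a) = a].
Proof.
case: a => i d; have li := ltn_ord i; have ld := ltn_ord d.
rewrite /lo /hi /=; split; try lia.
by congr (_, _); apply: val_inj => /=; rewrite modn_small; lia.
Qed.

Lemma arc_shift q i j : arc (i + q * R) (j + q * R) = arc i j.
Proof.
by congr (_, _); apply: val_inj => /=; rewrite ?subnDr // addnC modnMDl.
Qed.

Lemma arc_lohi i j : i < j <= i + R ->
  exists q, i = lo (arc i j) + q * R /\ j = hi (arc i j) + q * R.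
Proof.
move=> ij; exists (i %/ R); rewrite /lo /hi /=.
rewrite (@modn_small (j - i).-1); last by lia.
by have := divn_eq i R; lia.
Qed.

(** Lifts in the required relative position differ from those chosen in [complement] by one common
    multiple of the period. *)
Lemma complement_arc i j k l : lifted R i j k l ->
  complement (arc i j) (arc k l) =
    [seq arc p.1 p.2 | p <- lift_complement R i j k l].
Proof.
move=> ijkl; have [ij ik kl] := ijkl.
have [q [Ei Ej]] := arc_lohi ij; have [q' [Ek El]] := arc_lohi kl.
rewrite /complement; set s := if _ then _ else _.
have [ri lhi _] := arcP (arc i j); have [rk lhk _] := arcP (arc k l).
set i0 := lo (arc i j) in Ei ri s lhi *; set j0 := hi (arc i j) in Ej lhi *.
set k0 := lo (arc k l) in Ek rk s lhk *; set l0 := hi (arc k l) in El lhk *.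
have sE : (s + q * R = q' * R)%N.
  have Eq : (q' = q + (k0 < i0))%N.
    have q1 : q <= q'.
      by rewrite leqNgt; apply/negP => /leq_mul/(_ (leqnn R)); lia.
    have q2 : q' <= q.+1.
      by rewrite leqNgt; apply/negP => /leq_mul/(_ (leqnn R)); lia.
    have [E|E] : q' = q \/ q' = q.+1 by lia.
      by rewrite E in Ek *; case: (ltnP k0 i0) => /= c; lia.
    by rewrite E mulSn in Ek *; case: (ltnP k0 i0) => /= c; lia.
  by rewrite Eq mulnDl /s; case: ifP => _ /=; lia.
have sh : lifted R i0 j0 (k0 + s) (l0 + s).
  by clearbody s; split; lia.
pose psi x := (x + q * R)%N.
have := @lift_complement_map R R psi i0 j0 (k0 + s) (l0 + s) _ _ sh.
rewrite /psi -!addnA sE -Ei -Ej -Ek -El => ->.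
- by rewrite -map_comp; apply: eq_map => p /=; rewrite arc_shift.
- by move=> x y; rewrite ltn_add2r.
- by move=> x; rewrite addnAC.
Qed.

Lemma complement_aa a : complement a a = [::].
Proof.
have [_ la <-] := arcP a; rewrite complement_arc; last by split; lia.
by rewrite /lift_complement !eqxx; case: eqP.
Qed.

Lemma complement_size a b : size (complement a b) = size (complement b a).
Proof.
wlog ab : a b / lo a <= lo b.
  by move=> W; case: (leqP (lo a) (lo b)) => [|/ltnW] /W.
have [? ? Ea] := arcP a; have [? ? Eb] := arcP b.
have -> : complement a b =
  [seq arc p.1 p.2 | p <- lift_complement R (lo a) (hi a) (lo b) (hi b)].
  by rewrite -complement_arc ?Ea ?Eb //; split; lia.
have [E|] := eqVneq (lo a) (lo b).
  have -> : complement b a =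
    [seq arc p.1 p.2 | p <- lift_complement R (lo b) (hi b) (lo a) (hi a)].
    by rewrite -complement_arc ?Ea ?Eb //; split; lia.
  rewrite !size_map /lift_complement; do ![case: ifP => /= ?] => //; lia.
move=> neq.
have -> : complement b a =
  [seq arc p.1 p.2 | p <- lift_complement R (lo b) (hi b) (lo a + R) (hi a + R)].
  rewrite -complement_arc; last by split; lia.
  by rewrite -[X in (_ + X)%N]mul1n -[X in arc _ (_ + X)]mul1n arc_shift Ea Eb.
rewrite !size_map /lift_complement; do ![case: ifP => /= ?] => //; lia.
Qed.

End Atoms.

Section Relabel.
Variables (m n : nat) (psi : nat -> nat).
Hypothesis psi_lt : {homo psi : x y / x < y}.
Hypothesis psi_shift : forall x, psi (x + m.+1) = psi x + n.+1.

Definition relabel (a : atom m) : atom n := arc n (psi (lo a)) (psi (hi a)).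

Lemma psi_shiftM q x : psi (x + q * m.+1) = psi x + q * n.+1.
Proof.
elim: q => [|q IHq]; first by rewrite !addn0.
by rewrite mulSnr addnA psi_shift IHq mulSnr addnA.
Qed.

Lemma relabel_arc i j : i < j <= i + m.+1 ->
  relabel (arc m i j) = arc n (psi i) (psi j).
Proof.
move=> ij; have [q [Ei Ej]] := arc_lohi ij.
by rewrite /relabel -(arc_shift _ q) -!psi_shiftM -Ei -Ej.
Qed.

Lemma complement_relabel a b :
  complement (relabel a) (relabel b) = map relabel (complement a b).
Proof.
have [ra la _] := arcP a; have [rb lb _] := arcP b.
rewrite {2}/complement; set s := if _ then _ else _.
have sh : lifted m.+1 (lo a) (hi a) (lo b + s) (hi b + s).
  by rewrite /s; case: (ltnP (lo b) (lo a)) => c; split; lia.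
have -> : relabel b = arc n (psi (lo b + s)) (psi (hi b + s)).
  rewrite /relabel /s; case: ifP => _; last by rewrite !addn0.
  by rewrite !psi_shift -[n.+1]mul1n arc_shift.
have psi_le : {mono psi : x y / x <= y} := leq_mono psi_lt.
have psi_ltE : {mono psi : x y / x < y} := leqW_mono psi_le.
rewrite complement_arc; last first.
  by case: sh => *; split; rewrite -?psi_shift ?psi_ltE ?psi_le.
rewrite (lift_complement_map psi_lt psi_shift sh) -!map_comp;
  apply/eq_in_map => p /=.
by move=> /(allP (lift_complement_valid sh)) /relabel_arc.
Qed.

End Relabel.

Definition atoms_at (n i : nat) : seq (atom n) := [seq arc n i j | j <- iota
  i.+1 n.+1].
(** By rotation, it is enough to let the first atom start at 0; 12 is an amount of fuel with which
    the reversings in the check succeed. *)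
Definition check_cubes (n : nat) : bool :=
  let s := flatten [seq atoms_at n i | i <- iota 0 n.+1] in
  all (fun a => all (fun b => all (cubeb (@complement n) 12 a b) s) s)
    (atoms_at n 0).

Lemma check_cubes_small : all check_cubes (iota 0 6).
Proof. by vm_compute. Qed.

Lemma mem_atoms_at n (a : atom n) : a \in atoms_at n (lo a).
Proof.
have [_ la Ea] := arcP a; rewrite -{1}Ea; apply: map_f.
by rewrite mem_iota; lia.
Qed.

Lemma check_cubes_lo0 m (a b d : atom m) : m < 6 -> lo a = 0 ->
  cube (@complement m) a b d.
Proof.
move=> m6 a0; have : check_cubes m by apply: (allP check_cubes_small);
  rewrite mem_iota.
rewrite /check_cubes; set s := flatten [seq atoms_at m i | i <- iota 0 m.+1].
have sP (x : atom m) : x \in s.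
  have [lx _ _] := arcP x; apply/flattenP; exists (atoms_at m (lo x)).
    by apply: map_f; rewrite mem_iota.
  exact: mem_atoms_at.
have aP : a \in atoms_at m 0 by rewrite -a0 mem_atoms_at.
move=> /allP/(_ a aP)/allP/(_ b (sP b))/allP/(_ d (sP d)).
exact: cubebP.
Qed.

Section SmallSupport.
Variables (n i : nat) (s : seq nat).
Hypotheses (s_sorted : sorted ltn s) (s_gt0 : 0 < size s).
Hypothesis s_lt : all (fun x => x < n.+1) s.

(** Extends the list of the points i + s periodically: it embeds a circle of [size s] points into
    the circle of n + 1 points. *)
Let psi x := i + (nth 0 s (x %% size s) + x %/ size s * n.+1).

Lemma support_lt : {homo psi : x y / x < y}.
Proof.
move=> x y xy; rewrite ltn_add2l.
have mx z : z %% size s < size s by rewrite ltn_mod.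
have nth_lt z : z < size s -> nth 0 s z < n.+1 by move=> /(mem_nth 0)/(allP s_lt).
have := leq_div2r (size s) (ltnW xy); rewrite leq_eqVlt => /predU1P[E|].
  have : x %% size s < y %% size s.
    by move: xy; rewrite {1}(divn_eq x (size s)) {1}(divn_eq y (size s)) E
      ltn_add2l.
  rewrite E ltn_add2r => xy'.
  by apply: (sorted_ltn_nth ltn_trans) => //; rewrite inE.
move=> /(leq_mul (leqnn n.+1)).
have := nth_lt _ (mx x); lia.
Qed.

Lemma support_shift x : psi (x + size s) = psi x + n.+1.
Proof. by rewrite /psi modnDr divnDr ?dvdnn // divnn s_gt0; lia. Qed.

Lemma support_onto x : i <= x -> (x - i) %% n.+1 \in s ->
  exists y, psi y = x.
Proof.
move=> ix xs; exists ((x - i) %/ n.+1 * size s + index ((x - i) %% n.+1) s).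
have lt : index ((x - i) %% n.+1) s < size s by rewrite index_mem.
rewrite /psi modnMDl (modn_small lt) nth_index // divnMDl // (divn_small lt)
  addn0.
by have := divn_eq (x - i) n.+1; lia.
Qed.

End SmallSupport.

(** Three atoms have at most six endpoints, so they come from a circle with at most six points by an
    increasing periodic relabelling, which preserves cubes. *)
Lemma complement_cube n (a b d : atom n) : cube (@complement n) a b d.
Proof.
(* Offsets are taken from [lo a], so that 0 heads the sorted list and [a] comes from an atom
   starting at 0, as the computed check assumes. *)
pose off x := (x + n.+1 - lo a) %% n.+1.
pose l := [:: off (lo a); off (hi a); off (lo b); off (hi b); off (lo d);
  off (hi d)].
pose s := sort leq (undup l).
have s_sorted : sorted ltn s.
  by rewrite ltn_sorted_uniq_leq sort_uniq undup_uniq sort_sorted //;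
    apply: leq_total.
have s_mem x : (x \in s) = (x \in l) by rewrite mem_sort mem_undup.
have [la ha _] := arcP a.
have off0 : off (lo a) = 0 by rewrite /off addKn modnn.
have zs : 0 \in s by rewrite s_mem -off0 inE eqxx.
have s_gt0 : 0 < size s by case: (s) zs.
have s0 : nth 0 s 0 = 0.
  apply/eqP; rewrite -leqn0.
  have := sorted_leq_nth leq_trans leqnn 0 (sub_sorted ltnW s_sorted).
  move=> /(_ 0 (index 0 s)); rewrite nth_index // !inE index_mem; exact.
have s_lt : all (fun x => x < n.+1) s.
  apply/allP => x; rewrite s_mem !inE => /or4P[||| /or3P[]] /eqP ->;
    exact: ltn_pmod.
have s6 : size s <= 6 by rewrite size_sort (leq_trans (size_undup _)).
case Es : (size s) s_gt0 s6 => [//|m] _ m6.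
have sgt : 0 < size s by rewrite Es.
pose psi x := lo a + (nth 0 s (x %% size s) + x %/ size s * n.+1).
have plt : {homo psi : x y / x < y} := support_lt (lo a) s_sorted sgt s_lt.
have psh x : psi (x + m.+1) = psi x + n.+1 by rewrite -Es; apply: support_shift.
have onto (c : atom n) : off (lo c) \in l -> off (hi c) \in l ->
    exists c', @relabel m n psi c' = c.
  move=> lc hc; have [rc hlc Ec] := arcP c.
  have E x : (x + n.+1 - lo a) %% n.+1 = off x by [].
  (* Adding a period brings the endpoint to at least [lo a], where the enumeration starts. *)
  have [x Ex] := @support_onto n (lo a) s s_sorted sgt s_lt (lo c + n.+1)
    ltac:(lia) ltac:(by rewrite E s_mem).
  have [y Ey] := @support_onto n (lo a) s s_sorted sgt s_lt (hi c + n.+1)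
    ltac:(lia) ltac:(by rewrite E s_mem).
  have ple := leq_mono plt.
  rewrite -/(psi x) in Ex; rewrite -/(psi y) in Ey.
  exists (arc m x y); rewrite (relabel_arc psh); last first.
    by rewrite -(leqW_mono ple) -(ple y) psh Ex Ey; lia.
  by rewrite Ex Ey -{1 2}[n.+1]mul1n arc_shift.
have [b' <-] := onto b ltac:(by rewrite !inE eqxx ?orbT) ltac:(by rewrite !inE
  eqxx ?orbT).
have [d' <-] := onto d ltac:(by rewrite !inE eqxx ?orbT) ltac:(by rewrite !inE
  eqxx ?orbT).
have p0 : psi 0 = lo a by rewrite /psi mod0n div0n s0 addn0.
have hia : (hi a - lo a) %% n.+1 \in s.
  rewrite s_mem -modnDr (_ : (_ + _)%N = hi a + n.+1 - lo a); last lia.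
  by rewrite -/(off _) !inE eqxx ?orbT.
have [y Ey] := @support_onto n (lo a) s s_sorted sgt s_lt (hi a) ltac:(lia) hia.
rewrite -/(psi y) in Ey.
have ple := leq_mono plt.
have ya : 0 < y <= 0 + m.+1.
  by rewrite -(leqW_mono ple) -(ple y) psh p0 Ey; lia.
have Ea : a = @relabel m n psi (arc m 0 y).
  by rewrite (relabel_arc psh) // p0 Ey; case: (arcP a) => _ _ ->.
rewrite {1}Ea; apply: cube_map; first exact: complement_relabel.
by apply: check_cubes_lo0.
Qed.

(** * The Coxeter element acts by rotation *)

Section ArcRelations.
Variables (n : nat) (K : monoidType) (al : atom n -> K).
Local Notation R := n.+1.
Hypothesis alR : forall a b,
  al a * \prod_(x <- complement a b) al x =
  al b * \prod_(x <- complement b a) al x.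
Local Notation A i j := (al (arc n i j)).

Lemma A_shift i j : A (i + R) (j + R) = A i j.
Proof. by rewrite -{1 2}[n.+1]mul1n arc_shift. Qed.

Lemma A_rel i j k l : i < j <= i + R -> i < k < i + R -> k < l <= k + R ->
  A i j * \prod_(p <- lift_complement R i j k l) A p.1 p.2 =
  A k l * \prod_(p <- lift_complement R k l (i + R) (j + R)) A p.1 p.2.
Proof.
move=> ij ik kl; have := alR (arc n i j) (arc n k l).
rewrite complement_arc; last by split=> //; lia.
rewrite -[X in complement (arc n k l) X](arc_shift _ 1) mul1n.
by rewrite complement_arc ?big_map //; split=> //; lia.
Qed.

Lemma A_rel_same i j k : i < j <= i + R -> i < k <= i + R ->
  A i j * \prod_(p <- lift_complement R i j i k) A p.1 p.2 =
  A i k * \prod_(p <- lift_complement R i k i j) A p.1 p.2.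
Proof.
move=> ij ik; have := alR (arc n i j) (arc n i k).
by rewrite !complement_arc ?big_map //; split=> //; lia.
Qed.

Ltac case_lifts :=
  rewrite /lift_complement;
  do ![case: ifP => /= ?; try (exfalso; lia)];
  rewrite ?big_cons ?big_nil ?mulg1 /=.

Lemma A_triangle i j k : i < j -> j < k -> k < i + R ->
  A i j * A j k = A j k * A i k.
Proof.
move=> ij jk ki; have := @A_rel i j j k ltac:(lia) ltac:(lia) ltac:(lia).
by case_lifts; rewrite A_shift.
Qed.

Lemma A_fan i j k : i < j -> j < k -> k < i + R ->
  A i k * A i j = A i j * A j k.
Proof.
move=> ij jk ki; have := @A_rel_same i k j ltac:(lia) ltac:(lia).
by case_lifts.
Qed.

Lemma A_radius i j : i < j < i + R -> A i (i + R) * A i j = A i j * A j (j + R).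
Proof.
move=> ij; have := @A_rel_same i (i + R) j ltac:(lia) ltac:(lia).
by case_lifts.
Qed.

Lemma A_radius_flip i j : i < j < i + R ->
  A i j * A j (j + R) = A j (j + R) * A j (i + R).
Proof.
move=> ij; have := @A_rel i j j (j + R) ltac:(lia) ltac:(lia) ltac:(lia).
by case_lifts.
Qed.

Lemma A_disjoint i j k l : i < j -> j < k -> k < l -> l < i + R ->
  commute (A i j) (A k l).
Proof.
move=> ij jk kl li; have := @A_rel i j k l ltac:(lia) ltac:(lia) ltac:(lia).
by case_lifts; rewrite A_shift.
Qed.

Lemma A_radius_arc i j k : i < j -> j < k -> k < i + R ->
  commute (A i (i + R)) (A j k).
Proof.
move=> ij jk ki; have := @A_rel i (i + R) j k ltac:(lia) ltac:(lia) ltac:(lia).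
by case_lifts; rewrite A_shift.
Qed.

Definition chain i j : K := \prod_(i <= m < j) A m m.+1.

Lemma chain_nil i : chain i i = 1.
Proof. by rewrite /chain big_geq. Qed.

Lemma chain_cat i j k : i <= j -> j <= k -> chain i k = chain i j * chain j k.
Proof. by move=> ij jk; rewrite /chain (big_cat_nat ij jk). Qed.

Lemma chain_recl i k : i < k -> chain i k = A i i.+1 * chain i.+1 k.
Proof. by move=> ik; rewrite /chain big_ltn. Qed.

Lemma chain_recr i k : i <= k -> chain i k.+1 = chain i k * A k k.+1.
Proof. by move=> ik; rewrite /chain big_nat_recr. Qed.

Lemma chain_shift i j : chain (i + R) (j + R) = chain i j.
Proof.
rewrite /chain big_addn addnK; apply: eq_big_nat => m _.
by rewrite -addSn A_shift.
Qed.

Lemma commute_chain x i j : (forall m, i <= m < j -> commute x (A m m.+1)) ->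
  commute x (chain i j).
Proof.
move=> xA; rewrite /chain big_nat; elim/big_rec: _ => [|m y im xy].
  exact: commute1.
exact/commuteM/xy/xA.
Qed.

Lemma chain_arcl d i : d < n ->
  A i (i + d).+1 * chain i (i + d) = chain i (i + d).+1.
Proof.
elim: d i => [|d IHd] i dn.
  by rewrite addn0 chain_nil mulg1 chain_recr // chain_nil mul1g.
rewrite (@chain_recl i (i + d.+1)) ?(@chain_recl i (i + d.+1).+1); try lia.
by rewrite mulgA A_fan; try lia; rewrite -mulgA -addSnnS IHd //; lia.
Qed.

Lemma chain_arcr d i : d < n ->
  chain i.+1 (i + d).+1 * A i (i + d).+1 = chain i (i + d).+1.
Proof.
elim: d => [|d IHd] dn.
  by rewrite addn0 chain_nil mul1g chain_recr // chain_nil mul1g.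
rewrite addnS chain_recr; last lia.
rewrite -mulgA -A_triangle; try lia.
by rewrite mulgA IHd -?chain_recr //; lia.
Qed.

Lemma radius_chain i d : d <= n ->
  A i (i + R) * chain i (i + d) = chain i (i + d) * A (i + d) (i + d + R).
Proof.
elim: d => [|d IHd] dn; first by rewrite !addn0 chain_nil mulg1 mul1g.
rewrite (addnS i d) chain_recr; last lia.
by rewrite mulgA IHd ?(ltnW dn) // -!mulgA A_radius //; lia.
Qed.

Definition coxeter i : K := A i (i + R) * chain i (i + n).

(** Pushing the radius past the arc (i, i + 1) turns that arc into (i + 1, i + R), which the
    remaining chain absorbs by [chain_arcl]. *)
Lemma coxeterS i : coxeter i = coxeter i.+1.
Proof.
have [n0|n_gt0] := posnP n.
  have E x : x + n = x by lia.
  by rewrite /coxeter !E !chain_nil !mulg1 -A_shift (_ : i.+1 = i + R)%N //; lia.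
rewrite /coxeter chain_recl; last lia.
rewrite mulgA A_radius; last lia.
rewrite A_radius_flip; last lia.
have [d Ed] : exists d, n = d.+1 by exists n.-1; lia.
have := @chain_arcl d i.+1 ltac:(lia).
rewrite (_ : (i.+1 + d)%N = (i + n)%N); last lia.
by rewrite -mulgA addSn addnS => ->.
Qed.

Lemma coxeterE i : coxeter i = coxeter 0.
Proof. by elim: i => // i <-; rewrite -coxeterS. Qed.

(** The same [x] completes the atom on the right and the rotated atom on the left; this yields both
    the rotation [coxeter_conj] and the divisibility of the Coxeter element by every atom. *)
Lemma coxeter_arc i j : i < j <= i + R ->
  exists x, coxeter 0 = A i.+1 j.+1 * x /\ coxeter 0 = x * A i j.
Proof.
move=> /andP[ij]; rewrite leq_eqVlt => /predU1P[->|ji].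
  exists (chain i.+1 (i.+1 + n)); rewrite -(coxeterE i.+1) /coxeter; split=> //.
  rewrite radius_chain // (_ : i.+1 + n = i + R)%N; last lia.
  by rewrite A_shift.
exists (chain i.+1 j * chain j.+1 (i + R) * A (i + R) (i + R + R)); split.
  rewrite -(coxeterE i.+1) /coxeter radius_chain //.
  rewrite (_ : i.+1 + n = i + R)%N; last lia.
  have := @chain_arcl (j - i.+1) i.+1 ltac:(lia).
  rewrite (_ : i.+1 + (j - i.+1) = j)%N; last lia.
  by rewrite !mulgA => ->; rewrite (@chain_cat _ j.+1) //; lia.
(* Starting the Coxeter element at j + 1 puts the chain from i to j last, and by [chain_arcr] the
   atom (i, j) splits off on its right. What remains is to commute the rest of that chain to the
   front. *)
rewrite -(coxeterE j.+1) /coxeter.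
have E : (A j.+1 (j.+1 + R) * chain j.+1 (i + R) =
    chain j.+1 (i + R) * A (i + R) (i + R + R)).
  have := @radius_chain j.+1 (i + R - j.+1) ltac:(lia).
  by rewrite (_ : j.+1 + (i + R - j.+1) = i + R)%N //; lia.
rewrite -(mulgA (chain i.+1 j)) -E.
rewrite (@chain_cat _ (i + R)); try lia.
have -> : chain (i + R) (j.+1 + n) = chain i j by rewrite addSnnS chain_shift.
have := @chain_arcr (j - i.+1) i ltac:(lia).
rewrite (_ : (i + (j - i.+1)).+1 = j)%N; last lia.
move=> <-; rewrite !mulgA; congr (_ * _); rewrite -!mulgA mulgA; symmetry.
apply/commute_sym/commute_chain => m mi; apply/commute_sym/commuteM.
  by rewrite -(A_shift m); apply/commute_sym/A_radius_arc; lia.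
by apply: commute_chain => p pi; apply: A_disjoint; lia.
Qed.

Lemma coxeter_conj i j : i < j <= i + R ->
  coxeter 0 * A i j = A i.+1 j.+1 * coxeter 0.
Proof. by move=> /coxeter_arc[x [-> E]]; rewrite -mulgA -E => {E}. Qed.

Lemma coxeterX_conj q i j : i < j <= i + R ->
  coxeter 0 ^+ q * A i j = A (i + q) (j + q) * coxeter 0 ^+ q.
Proof.
elim: q => [|q IHq] ij; first by rewrite !addn0 mul1g mulg1.
rewrite expgS -mulgA IHq // mulgA coxeter_conj; last lia.
by rewrite -mulgA !addnS.
Qed.

Lemma coxeterX_central a : commute (coxeter 0 ^+ R) (al a).
Proof.
have [_ la <-] := arcP a; rewrite /commute coxeterX_conj // A_shift //.
Qed.

End ArcRelations.

(** * Garside structure of the dual group and the centralizer of its arcs *)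

Section DualGroup.
Variable n : nat.
Local Notation R := n.+1.
Local Notation C := (@complement n).

Definition dual : groupType := cgroup C.
Definition ga i j : dual := cgen C (arc n i j).
Definition coxeter_word : seq (atom n) :=
  arc n 0 R :: [seq arc n m m.+1 | m <- index_iota 0 n].
Definition cox : dual := pos C coxeter_word.

Lemma coxeter_word_prod (K : monoidType) (al : atom n -> K) :
  \prod_(x <- coxeter_word) al x = coxeter al 0.
Proof. by rewrite big_cons big_map. Qed.

(** Delta is the R-th power of the Coxeter element, central because R rotations restore every atom;
    an atom divides the first factor of that power already. *)
Lemma garside_data : exists (Delta : seq (atom n)) (star : atom n ->
  seq (atom n)),
  [/\ forall a, commute (mcl C Delta) (mgen C a),
      forall a, mgen C a * mcl C (star a) = mcl C Delta
    & pos C Delta = cox ^+ R].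
Proof.
pose Delta := flatten (nseq R coxeter_word).
have DE (K : monoidType) (al : atom n -> K) :
    \prod_(x <- Delta) al x = coxeter al 0 ^+ R.
  rewrite /Delta; elim: R => [|k IHk]; first by rewrite big_nil.
  by rewrite big_cat IHk coxeter_word_prod expgS.
have mR a b := @mgen_rel _ C a b.
have DM : mcl C Delta = coxeter (mgen C) 0 ^+ R by rewrite mcl_prod DE.
have starE a : exists u, mgen C a * mcl C u = mcl C Delta.
  have [_ la <-] := arcP a; rewrite -(arc_shift n 1) mul1n !addnS.
  have [x [Ex _]] := @coxeter_arc _ _ _ mR (lo a + n) (hi a + n) ltac:(lia).
  exists (repr (x * coxeter (mgen C) 0 ^+ n)).
  by rewrite mcl_repr mulgA -Ex DM expgS.
have [star starP] := choice starE.
exists Delta, star; split=> //.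
- by move=> a; rewrite DM; apply: coxeterX_central.
- by rewrite /pos DE /cox /pos coxeter_word_prod.
Qed.

Lemma dual_pos_inj u v : pos C u = pos C v -> meq C u v.
Proof.
have [Delta [star [DC sP _]]] := garside_data.
exact: (pos_inj (@complement_aa n) (@complement_size n) (@complement_cube n) DC
  sP).
Qed.

Lemma ga_rel a b : cgen C a * \prod_(x <- C a b) cgen C x =
  cgen C b * \prod_(x <- C b a) cgen C x.
Proof. exact: cgen_rel. Qed.

Lemma cox_coxeter : cox = coxeter (cgen C) 0.
Proof. by rewrite /cox /pos coxeter_word_prod. Qed.

Lemma coxX_conj q i j : i < j <= i + R ->
  cox ^+ q * ga i j = ga (i + q) (j + q) * cox ^+ q.
Proof. by move=> ij; rewrite cox_coxeter (coxeterX_conj ga_rel). Qed.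

Lemma coxR_central x : commute x (cox ^+ R).
Proof.
elim/presented_ind: x => [|a|x y cx cy|x].
- exact/commute_sym/commute1.
- by rewrite cox_coxeter; apply/commute_sym/(coxeterX_central ga_rel).
- exact/commute_sym/commuteM/commute_sym/cy/commute_sym.
- by move=> cx; apply/commute_sym/commuteV/commute_sym.
Qed.

(** Radii are left out because, among the images of the generators of B(de, e, r), a radius occurs
    only through its e-th power. A general [q] is needed for dividing out Coxeter elements one by
    one. *)
Definition rotates q (x : dual) := forall i j, i < j < i + R ->
  x * ga i j = ga (i + q) (j + q) * x.

(** The arc (i, j) times the element is again the element times an arc, hence a common multiple of
    (i, j) and [a]. Cancelling (i, j) leaves the stated divisor of the element itself. *)
Lemma rotates_lcm q a u i j : rotates q (pos C (a :: u)) -> i < j < i + R ->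
  exists w, meq C (a :: u) (C (arc n i j) a ++ w).
Proof.
(* Rotating by q n and then by q is a multiple of the full turn. *)
move=> rot ij; have := rot (i + q * n) (j + q * n) ltac:(lia).
rewrite -!addnA -!mulnSr {2}/ga arc_shift => E.
have /dual_pos_inj/(meq_lcm (@complement_aa n) (@complement_size n)
    (@complement_cube n))[w [_ uw]] :
    pos C (a :: (u ++ [:: arc n (i + q * n) (j + q * n)])) =
    pos C (arc n i j :: a :: u).
  rewrite -[a :: (u ++ _)]/((a :: u) ++ _) pos_cat {2}/pos big_seq1 -/(ga _ _).
  by rewrite E [in RHS]/pos big_cons.
by exists w.
Qed.

Ltac case_lifts :=
  rewrite complement_arc; [| by split; lia]; rewrite /lift_complement;
  do ![case: ifP => /= ?; try (exfalso; lia)].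

Lemma arc_radius i j : i = j %[mod R] -> arc n i (i + R) = arc n j (j + R).
Proof.
by move=> ij; congr (_, _); apply: val_inj => /=; rewrite ?addKn.
Qed.

(** A first letter (l, h) that is not a radius gives one through its complement to the arc (h, l +
    R). A radius at k then gives the radius at j through the arc (k, j). *)
Lemma rotates_radius q u i : u != [::] -> rotates q (pos C u) ->
  exists w, meq C u (arc n i (i + R) :: w).
Proof.
case: u => // a u _ rot.
have [k [w uw]] : exists k w, meq C (a :: u) (arc n k (k + R) :: w).
  have [_ /andP[la]] := arcP a; rewrite leq_eqVlt => /predU1P[E|ha] Ea.
    by exists (lo a), u; rewrite -E Ea; apply: MeqRefl.
  have [w] := @rotates_lcm q a u (hi a) (lo a + R) rot ltac:(lia).
  rewrite -[X in C _ X]Ea -(arc_shift n 1 (lo a)) mul1n; case_lifts.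
  by rewrite /= => uw; exists (lo a + R)%N, w.
pose j := k + (i + k * n) %% R.
(* [j] is the representative of the residue of [i] in the period starting at [k]. *)
have -> : arc n i (i + R) = arc n j (j + R).
  apply: arc_radius; rewrite /j modnDmr addnCA -mulnS addnC.
  by rewrite modnMDl.
have [E|ne] := eqVneq k j; first by exists w; rewrite -E.
have kj : k < j < k + R.
  by have := ltn_pmod (i + k * n) (ltn0Sn n); rewrite /j in ne *; lia.
rewrite (pos_meq uw) in rot.
have [v] := @rotates_lcm q _ w k j rot kj.
case_lifts => /= wv; exists v; exact: meq_trans uw wv.
Qed.

(* Dividing out the chain of c one letter at a time: once (k, k + 1) has been  *)
(* removed, the remaining (k, j) become (k + 1, j).                            *)
Lemma coxeter_word_divides u :
  (forall i, exists w, meq C u (arc n i (i + R) :: w)) ->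
  exists w, meq C u (coxeter_word ++ w).
Proof.
move=> rad; have [v uv] := rad 0.
have ML a b x y := @meq_lcm _ _ (@complement_aa n) (@complement_size n)
  (@complement_cube n) a b x y.
have v0 j : 0 < j <= n -> exists w, meq C v (arc n 0 j :: w).
  move=> jn; have [w uw] := rad j.
  have [x [vx _]] := ML _ _ _ _ (meq_trans (meq_sym uv) uw).
  by exists x; move: vx; case_lifts.
have step k : k <= n -> exists w,
    meq C v ([seq arc n m m.+1 | m <- index_iota 0 k] ++ w) /\
    forall j, k < j <= n -> exists x, meq C w (arc n k j :: x).
  elim: k => [|k IHk] kn; first by exists v; split=> //; apply: MeqRefl.
  have [w [vw wk]] := IHk (ltnW kn); have [x wx] := wk k.+1 ltac:(lia).
  exists x; split=> [|j kj].
    rewrite /index_iota subn0 -(addn1 k) iotaD map_cat -catA.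
    apply: meq_trans vw _; rewrite /index_iota subn0; exact: meq_catl.
  have [y wy] := wk j ltac:(lia).
  have [z [xz _]] := ML _ _ _ _ (meq_trans (meq_sym wx) wy).
  by exists z; move: xz; case_lifts.
have [w [vw _]] := step n (leqnn n).
exists w; apply: meq_trans uv _; exact: (meq_catl [:: _] vw).
Qed.

(** A nonempty such word is divisible by all radii, hence by the Coxeter element, and the shorter
    quotient rotates arcs again. *)
Lemma rotates_pos q u : rotates q (pos C u) -> exists k, pos C u = cox ^+ k.
Proof.
have [l] := ubnP (size u); elim: l => // l IHl in q u *; rewrite ltnS => szu rot.
have [->|u0] := eqVneq u [::]; first by exists 0; rewrite /pos big_nil.
have [w uw] := coxeter_word_divides (fun i => rotates_radius i u0 rot).
have szw : size w < l.
  apply: leq_trans szu; rewrite (meq_size (@complement_size n) uw) size_cat.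
  by rewrite /= addSn ltnS leq_addl.
have E := pos_meq uw; rewrite pos_cat -/cox in E.
(* The quotient rotates by q - 1, which is q + n modulo the period. *)
have rw : rotates (q + n) (pos C w).
  move=> i j ij; apply: (mulgI cox).
  have cE : cox * ga (i + (q + n)) (j + (q + n)) = ga (i + q) (j + q) * cox.
    have := @coxX_conj 1 (i + (q + n)) (j + (q + n)) ltac:(lia).
    have sh k : k + (q + n) + 1 = k + q + 1 * R by lia.
    by rewrite expg1 !sh {2}/ga arc_shift.
  by rewrite mulgA -E rot // mulgA cE -mulgA -E.
have [k wk] := IHl _ _ szw rw.
by exists k.+1; rewrite E wk expgS.
Qed.

(** After multiplication by a central power of Delta, [x] is a positive element that rotates arcs by
    0. *)
Lemma dual_center x :
  (forall i j, i < j < i + R -> commute x (ga i j)) ->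
  exists p q, cox ^+ p * x = cox ^+ q.
Proof.
move=> xA; have [Delta [star [DC sP DE]]] := garside_data.
have [p [u pu]] := pos_fraction DC sP x.
have [q uq] : exists q, pos C u = cox ^+ q.
  apply: (@rotates_pos 0) => i j ij; rewrite !addn0 -pu DE -expgnA.
  rewrite -mulgA xA // !mulgA; congr (_ * _).
  by rewrite expgnA; apply/commute_sym/commuteX/coxR_central.
by exists (R * p)%N, q; rewrite -uq -pu DE expgnA.
Qed.

Lemma dual_root_conjugate N (g k : dual) : 0 < N ->
  (forall a, exists b, k * cgen C a = cgen C b * k) ->
  (forall x, commute (k ^+ N) x) -> g ^+ N = k ^+ N ->
  exists x, g = k ^ x.
Proof.
move=> N_gt0 kA kN gk; have [Delta [star [DC sP _]]] := garside_data.
apply: (root_conjugate (@complement_aa n) (@complement_size n)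
  (@complement_cube n) DC sP N_gt0 _ kN gk) => a.
have [b kb] := kA a; exists [:: b].
by rewrite /pos big_seq1 conjgE invgK mulgA kb mulgK.
Qed.

End DualGroup.

(** * Arcs from annular braids *)

Section BasicRelations.
Variables (n : nat) (K : monoidType) (A : nat -> nat -> K).
Local Notation R := n.+1.
Hypothesis shift : forall i j, A (i + R) (j + R) = A i j.
Hypothesis triangle : forall i j k, i < j -> j < k -> k < i + R ->
  A i j * A j k = A j k * A i k.
Hypothesis fan : forall i j k, i < j -> j < k -> k < i + R ->
  A i k * A i j = A i j * A j k.
Hypothesis radius : forall i j, i < j < i + R ->
  A i (i + R) * A i j = A i j * A j (j + R).
Hypothesis radius_flip : forall i j, i < j < i + R ->
  A i j * A j (j + R) = A j (j + R) * A j (i + R).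
Hypothesis disjoint : forall i j k l, i < j -> j < k -> k < l -> l < i + R ->
  commute (A i j) (A k l).
Hypothesis nested : forall i j k l, i < j -> j < k -> k < l -> l < i + R ->
  commute (A i l) (A j k).
Hypothesis radius_arc : forall i j k, i < j -> j < k -> k < i + R ->
  commute (A i (i + R)) (A j k).

Lemma radius_flip' i j : i < j < i + R ->
  A j (i + R) * A i (i + R) = A j (j + R) * A j (i + R).
Proof. by move=> ij; rewrite radius ?shift //; lia. Qed.

Lemma square i j : i < j < i + R ->
  A i (i + R) * A i j = A j (i + R) * A i (i + R).
Proof. by move=> ij; rewrite radius // radius_flip // radius_flip'. Qed.

Lemma quad i j k l : i < j -> j < k -> k < l -> l < i + R ->
  A i k * (A i j * A k l) = A j l * (A j k * A i l).
Proof.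
move=> ij jk kl li; rewrite mulgA fan // -?mulgA; last lia.
rewrite -fan //; last lia.
rewrite mulgA triangle // -?mulgA; last lia.
by congr (_ * _); apply: nested.
Qed.

Lemma triangle_radius i h k : i < h -> h < k -> k < i + R ->
  A i (i + R) * (A i h * A h k) = A k (h + R) * (A k (i + R) * A h (h + R)).
Proof.
move=> ih hk ki.
rewrite [RHS]mulgA fan ?shift; try lia.
rewrite -mulgA -radius; last lia.
rewrite [RHS]mulgA -square; last lia.
by rewrite -[RHS]mulgA fan //; lia.
Qed.

Lemma triangle_center i k j : i < k -> k < j -> j < i + R ->
  A i j * (A i k * A j (j + R)) = A k (i + R) * (A k j * A i (i + R)).
Proof.
move=> ik kj ji.
have -> : A i j * (A i k * A j (j + R)) = A i (i + R) * (A i k * A k j).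
  rewrite mulgA fan // -mulgA -radius; last lia.
  by rewrite mulgA -radius -?mulgA //; lia.
rewrite [RHS]mulgA fan; try lia.
rewrite -mulgA -square; last lia.
rewrite [RHS]mulgA -(radius_arc (i := i)) //.
by rewrite -[RHS]mulgA -triangle //; lia.
Qed.

Lemma quad_center i h j k : i < h -> h < j -> j < k -> k < i + R ->
  A i k * (A i h * (A h j * A k (k + R))) =
  A j (h + R) * (A j k * (A k (i + R) * A h (h + R))).
Proof.
move=> ih hj jk ki.
have kc : commute (A k (k + R)) (A i h * A h j).
  by apply: commuteM; rewrite -[X in commute _ X]shift; apply: radius_arc; lia.
have hc : commute (A h (h + R)) (A j k * A k (i + R)).
  by apply: commuteM; apply: radius_arc; lia.
transitivity (A h (h + R) * (A h j * (A j k * A k (i + R)))).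
  rewrite (mulgA (A i h)) -kc mulgA -radius; last lia.
  rewrite -[LHS]mulgA (mulgA (A i k)) fan //; last lia.
  rewrite -(mulgA (A i h)) fan //; last lia.
  rewrite mulgA radius; last lia.
  rewrite radius_flip -?mulgA; last lia.
  congr (_ * _); rewrite mulgA fan -?mulgA; try lia.
  by congr (_ * _); rewrite fan //; lia.
by rewrite (mulgA (A j k)) -hc [RHS]mulgA -square -?mulgA //; lia.
Qed.

Ltac case_lifts :=
  rewrite /lift_complement; do ![case: ifP => /= ?; try (exfalso; lia)];
  rewrite ?big_cons ?big_nil ?mulg1 /= ?addnK ?shift.

(** Case analysis on the relative position of the two pairs of chords. Every configuration reduces
    to a hypothesis of the section or to one of the composite identities above, possibly with a
    point moved by a period. *)
Lemma lift_complement_rel i j k l : i < j <= i + R -> i < k < i + R ->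
  k < l <= k + R ->
  A i j * \prod_(p <- lift_complement R i j k l) A p.1 p.2 =
  A k l * \prod_(p <- lift_complement R k l (i + R) (j + R)) A p.1 p.2.
Proof.
move=> ij ik kl.
have [Ej|jR] := eqVneq j (i + R).
  subst j; case: (ltngtP l (i + R)) => [li|li|El].
  - case_lifts; apply: radius_arc; lia.
  - have [El|lk] := eqVneq l (k + R).
      subst l; case_lifts; rewrite square -?radius_flip' //; lia.
    have [h Eh] : exists h, l = h + R by exists (l - R); lia.
    subst l; case_lifts; apply: triangle_radius; lia.
  - by subst l; case_lifts; apply: square; lia.
have {jR}ij' : i < j < i + R by lia.
case: (ltngtP k j) => [kj|jk|Ek].
- case: (ltngtP l j) => [lj|jl|El].
  + case_lifts; apply: nested; lia.
  + case: (ltngtP l (i + R)) => [li|li|El].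
    * case_lifts; apply: quad; lia.
    * have [El|lk] := eqVneq l (k + R).
        subst l; case_lifts.
        have := @triangle_radius k j (i + R) ltac:(lia) ltac:(lia) ltac:(lia).
        by rewrite !shift => ->.
      have [h Eh] : exists h, l = h + R by exists (l - R); lia.
      subst l; case_lifts; apply: quad_center; lia.
    * by subst l; case_lifts; apply: triangle_center; lia.
  + by subst l; case_lifts; rewrite fan ?triangle //; lia.
- case: (ltngtP l (i + R)) => [li|li|El].
  + case_lifts; apply: disjoint; lia.
  + case: (ltngtP l (j + R)) => [lj|lj|El].
    * have [h Eh] : exists h, l = h + R by exists (l - R); lia.
      subst l; case_lifts.
      have := @quad k (i + R) (h + R) (j + R) ltac:(lia) ltac:(lia) ltac:(lia)
        ltac:(lia).
      by rewrite !shift => <-.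
    * have [El|lk] := eqVneq l (k + R).
        subst l; case_lifts; rewrite -(shift i j);
          apply/commute_sym/radius_arc; lia.
      case_lifts; rewrite -(shift i j); apply/commute_sym/nested; lia.
    * subst l; case_lifts.
      have := @fan k (i + R) (j + R) ltac:(lia) ltac:(lia) ltac:(lia).
      have := @triangle k (i + R) (j + R) ltac:(lia) ltac:(lia) ltac:(lia).
      by rewrite !shift => -> ->.
  + subst l; case_lifts.
    have := @fan k (i + R) (j + R) ltac:(lia) ltac:(lia) ltac:(lia).
    have := @triangle k (i + R) (j + R) ltac:(lia) ltac:(lia) ltac:(lia).
    by rewrite !shift => -> _.
- subst k; case: (ltngtP l (i + R)) => [li|li|El].
  + by case_lifts; apply: triangle; lia.
  + have [El|lk] := eqVneq l (j + R).
      by subst l; case_lifts; apply: radius_flip; lia.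
    have [h Eh] : exists h, l = h + R by exists (l - R); lia.
    subst l; case_lifts.
    have := @triangle_center j (i + R) (h + R) ltac:(lia) ltac:(lia) ltac:(lia).
    by rewrite !shift => <-.
  + by subst l; case_lifts; rewrite radius_flip // radius_flip'.
Qed.

Lemma lift_complement_rel_same i j k : i < j <= i + R -> i < k <= i + R ->
  A i j * \prod_(p <- lift_complement R i j i k) A p.1 p.2 =
  A i k * \prod_(p <- lift_complement R i k i j) A p.1 p.2.
Proof.
wlog jk : j k / k <= j.
  by move=> W ij ik; case: (leqP k j) => [|/ltnW] /W-> .
move=> ij ik; have [->//|kj] := eqVneq k j.
have [Ej|jR] := eqVneq j (i + R).
  by subst j; case_lifts; apply: radius; lia.
by case_lifts; apply: fan; lia.
Qed.

Lemma shiftM q i j : A (i + q * R) (j + q * R) = A i j.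
Proof.
elim: q => [|q IHq]; first by rewrite !addn0.
by rewrite !mulSnr !addnA shift.
Qed.

Definition arc_value (a : atom n) : K := A (lo a) (hi a).

Lemma arc_valueE i j : i < j <= i + R -> arc_value (arc n i j) = A i j.
Proof.
by move=> /arc_lohi[q [Ei Ej]]; rewrite [in RHS]Ei [in RHS]Ej shiftM.
Qed.

Lemma arc_value_prod i j k l : lifted R i j k l ->
  \prod_(x <- complement (arc n i j) (arc n k l)) arc_value x =
  \prod_(p <- lift_complement R i j k l) A p.1 p.2.
Proof.
move=> ijkl; rewrite complement_arc // big_map; apply: eq_big_seq => p.
by move=> /(allP (lift_complement_valid ijkl)) /arc_valueE.
Qed.

Lemma arc_value_rel a b :
  arc_value a * \prod_(x <- complement a b) arc_value x =
  arc_value b * \prod_(x <- complement b a) arc_value x.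
Proof.
wlog ab : a b / lo a <= lo b.
  by move=> W; case: (leqP (lo a) (lo b)) => [|/ltnW] /W.
have [ra la Ea] := arcP a; have [rb lb Eb] := arcP b.
have -> : complement a b = complement (arc n (lo a) (hi a)) (arc n (lo b) (hi b)).
  by rewrite Ea Eb.
rewrite arc_value_prod; last by split; lia.
have [E|ne] := eqVneq (lo a) (lo b).
  have -> : complement b a =
    complement (arc n (lo b) (hi b)) (arc n (lo a) (hi a)).
    by rewrite Ea Eb.
  rewrite arc_value_prod; last by split; lia.
  by rewrite /arc_value -E lift_complement_rel_same //; lia.
have -> : complement b a =
  complement (arc n (lo b) (hi b)) (arc n (lo a + R) (hi a + R)).
  by rewrite -[X in (_ + X)%N]mul1n -[X in arc _ _ (_ + X)]mul1n arc_shift Ea Eb.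
by rewrite arc_value_prod; [apply: lift_complement_rel; lia|split; lia].
Qed.

End BasicRelations.

(** * Arcs from a rotation and half-twists *)

Section AnnularBraids.
Variables (n : nat) (K : groupType) (rho : K) (sigma : nat -> K).
Local Notation R := n.+1.
Hypothesis rho_sigma : forall i, rho * sigma i = sigma i.+1 * rho.
Hypothesis sigma_period : forall i, sigma (i + R) = sigma i.
Hypothesis sigma_braid : 1 < n -> forall i,
  sigma i * sigma i.+1 * sigma i = sigma i.+1 * sigma i * sigma i.+1.
Hypothesis sigma_far : forall i j, i.+1 < j < i + n ->
  commute (sigma i) (sigma j).

Definition sprod i j : K := \prod_(i <= m < j) sigma m.
Local Notation w := sprod.

Lemma sprod_nil i : w i i = 1.
Proof. by rewrite /sprod big_geq. Qed.

Lemma sprod_cat j i k : i <= j -> j <= k -> w i k = w i j * w j k.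
Proof. by move=> ij jk; rewrite /sprod (big_cat_nat ij jk). Qed.

Lemma sprod1 i : w i i.+1 = sigma i.
Proof. by rewrite /sprod big_nat1. Qed.

Lemma sprod_shift i j : w (i + R) (j + R) = w i j.
Proof.
by rewrite /sprod big_addn addnK; apply: eq_bigr => m _; rewrite sigma_period.
Qed.

Lemma commute_sprod x i j : (forall m, i <= m < j -> commute x (sigma m)) ->
  commute x (w i j).
Proof.
move=> xA; rewrite /sprod big_nat; elim/big_rec: _ => [|m y im xy].
  exact: commute1.
exact/commuteM/xy/xA.
Qed.

Lemma sprod_far i j k l : j < k -> l < i + R -> commute (w i j) (w k l).
Proof.
move=> jk li; apply: commute_sprod => p kp.
apply/commute_sym/commute_sprod => m im.
by apply/commute_sym/sigma_far; lia.
Qed.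

(** The rotation stands in for a product of half-twists over a whole turn: like [w i k], it carries
    [sigma m] to [sigma m.+1] ([full_sigma]), so arcs and radii are treated uniformly. *)
Definition full i k : K := if k == i + R then rho else w i k.

Lemma full_lt i k : k < i + R -> full i k = w i k.
Proof. by rewrite /full => /ltn_eqF->. Qed.

Lemma full_radius i : full i (i + R) = rho.
Proof. by rewrite /full eqxx. Qed.

Lemma rho_sprod a b : rho * w a b = w a.+1 b.+1 * rho.
Proof.
rewrite /sprod big_add1 /=; elim/big_rec2: _ => [|m x y _ E].
  by rewrite mulg1 mul1g.
by rewrite mulgA rho_sigma -!mulgA E.
Qed.

Lemma full_sigma i k m : i <= m -> m.+1 < k -> k <= i + R ->
  full i k * sigma m = sigma m.+1 * full i k.
Proof.
move=> im mk ki; rewrite /full; case: eqP => [_|kR]; first exact: rho_sigma.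
rewrite (@sprod_cat m i k) 1?(@sprod_cat m.+2 m k); try lia.
have -> : w m m.+2 = sigma m * sigma m.+1.
  by rewrite (@sprod_cat m.+1) // !sprod1.
rewrite -!mulgA -(_ : commute (sigma m) (w m.+2 k)); last first.
  by rewrite -sprod1; apply: sprod_far; lia.
rewrite (mulgA (sigma m.+1)) (mulgA (sigma m)) (mulgA (sigma m)) sigma_braid;
  last lia.
rewrite -!mulgA mulgA [RHS]mulgA; congr (_ * _).
rewrite -sprod1; apply: sprod_far; lia.
Qed.

Lemma full_sprod i k a b : i <= a -> b < k -> k <= i + R ->
  full i k * w a b = w a.+1 b.+1 * full i k.
Proof.
move=> ia bk ki; rewrite /sprod big_add1 /= !big_nat.
elim/big_rec2: _ => [|m x y am E]; first by rewrite mulg1 mul1g.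
by rewrite mulgA full_sigma -?mulgA ?E //; lia.
Qed.

(** For k < i + R this is the Birman-Ko-Lee band generator, the conjugate of [sigma i] by
    [w i.+1 k]. *)
Definition alpha i k : K := (w i.+1 k)^-1 * full i k.

Lemma alphaE i k : i <= k <= i + n -> alpha i k.+1 = full i k.+1 * (w i k)^-1.
Proof.
move=> ik; apply: (mulIg (w i k)); rewrite mulgVK /alpha -mulgA full_sprod;
  try lia.
by rewrite mulKg.
Qed.

Lemma alpha_lt i k : k < i + R -> alpha i k = (w i.+1 k)^-1 * w i k.
Proof. by move=> ki; rewrite /alpha full_lt. Qed.

Lemma full_alpha i k a b : i <= a -> a < b -> b < k -> k <= i + R ->
  full i k * alpha a b = alpha a.+1 b.+1 * full i k.
Proof.
move=> ia ab bk ki; rewrite !alpha_lt; try lia.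
rewrite -[RHS]mulgA -full_sprod //; apply: (mulgI (w a.+2 b.+1)).
by rewrite mulVKg !mulgA -full_sprod ?mulgK //; lia.
Qed.

Lemma alpha_shift i j : alpha (i + R) (j + R) = alpha i j.
Proof.
by rewrite /alpha /full eqn_add2r -addSn !sprod_shift.
Qed.

Lemma alpha_prod i j k : i <= j -> j < k -> k < i + n ->
  alpha i j.+1 * alpha j.+1 k.+1 = w i k.+1 * (w i j * w j.+1 k)^-1.
Proof.
move=> ij jk ki; rewrite !alphaE; try lia.
rewrite !full_lt; try lia.
have c : commute (w j.+1 k.+1) (w i j) by apply/commute_sym/sprod_far; lia.
rewrite -mulgA (mulgA _ (w j.+1 k.+1)) -(commuteV c) -mulgA.
rewrite mulgA -sprod_cat; try lia.
by rewrite -invgM (@sprod_far i j); try lia.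
Qed.

Lemma alpha_triangle i j k : i < j -> j < k -> k < i + R ->
  alpha i j * alpha j k = alpha j k * alpha i k.
Proof.
case: j => // j; case: k => // k ij jk ki; rewrite alpha_prod; try lia.
rewrite (@alphaE i k); last lia.
rewrite mulgA -full_alpha; try lia.
rewrite full_lt // alpha_lt; last lia.
rewrite -!mulgA; congr (_ * _); rewrite (@sprod_cat j i k); try lia.
by rewrite !invgM mulVKg.
Qed.

Lemma alpha_fan i j k : i < j -> j < k -> k < i + R ->
  alpha i k * alpha i j = alpha i j * alpha j k.
Proof.
case: j => // j; case: k => // k ij jk ki; rewrite alpha_prod; try lia.
rewrite !alphaE; try lia.
rewrite !full_lt; try lia.
rewrite -mulgA (@sprod_cat j.+1 i k); try lia.
by rewrite invgM -(mulgA (w j.+1 k)^-1) mulKg -invgM.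
Qed.

Lemma alpha_disjoint i j k l : i < j -> j < k -> k < l -> l < i + R ->
  commute (alpha i j) (alpha k l).
Proof.
move=> ij jk kl li; rewrite !alpha_lt; try lia.
have c a b : k <= a -> b <= l -> commute (alpha i j) (w a b).
  move=> ka bl; rewrite alpha_lt; last lia.
  apply: commute_sym; apply: commuteM; last by apply/commute_sym/sprod_far; lia.
  apply: commuteV; apply/commute_sym/sprod_far; lia.
by rewrite -alpha_lt; [apply: commuteM; [apply: commuteV|]; apply: c; lia|lia].
Qed.

Lemma alpha_nested i j k l : i < j -> j < k -> k < l -> l <= i + R ->
  commute (alpha i l) (alpha j k).
Proof.
case: l => // l; case: j => // j; case: k => // k ij jk kl li.
rewrite /commute alphaE; last lia.
have fE : w i l * alpha j k = alpha j.+1 k.+1 * w i l.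
  by rewrite -full_lt ?full_alpha //; lia.
rewrite -mulgA [RHS]mulgA -full_alpha; try lia.
rewrite -[RHS]mulgA; congr (_ * _); apply: (mulgI (w i l)).
by rewrite mulVKg mulgA fE mulgK.
Qed.

Lemma radius_alpha i j : i < j.+1 < i + R ->
  alpha i (i + R) * alpha i j.+1 = rho * (w i j * w j.+1 (i + n))^-1.
Proof.
move=> ij; rewrite addnS !alphaE -?addnS; try lia.
rewrite full_radius full_lt; last lia.
rewrite -mulgA (@sprod_cat j.+1 i (i + n)); try lia.
rewrite invgM -(mulgA (w j.+1 (i + n))^-1) mulKg.
by rewrite -invgM.
Qed.

(** Both products equal the rotation divided by the two chains left after omitting the half-twists
    at j - 1 and at i + n. *)
Lemma alpha_radius_flip i j : i < j < i + R ->
  alpha i j * alpha j (j + R) = alpha j (j + R) * alpha j (i + R).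
Proof.
case: j => // j ij.
have -> : alpha j.+1 (j.+1 + R) * alpha j.+1 (i + R) =
    rho * (w i j * w j.+1 (i + n))^-1.
  rewrite (addnS i n) radius_alpha; last lia.
  rewrite (_ : j.+1 + n = j + R)%N -?(addnS i n) ?sprod_shift; last lia.
  by rewrite (@sprod_far i j); try lia.
rewrite /alpha full_radius full_lt; last lia.
rewrite (@sprod_cat (i + R) j.+2); try lia.
rewrite sprod_shift.
rewrite invgM !mulgA mulgK -invgM; symmetry.
apply: (mulIg (w i j * w j.+1 (i + n))); rewrite mulgVK.
rewrite -mulgA (mulgA rho) rho_sprod -mulgA rho_sprod -addnS mulgA.
rewrite -(@sprod_far i.+1 j.+1 j.+2 (i + R)); try lia.
by rewrite invgM mulgVK mulKg.
Qed.

Lemma alpha_radius i j : i < j < i + R ->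
  alpha i (i + R) * alpha i j = alpha i j * alpha j (j + R).
Proof.
move=> ij; rewrite alpha_radius_flip //; case: j => // j in ij *.
rewrite radius_alpha // [in RHS](addnS i n) radius_alpha; last lia.
rewrite (_ : j.+1 + n = j + R)%N -?(addnS i n) ?sprod_shift; last lia.
by rewrite (@sprod_far i j); try lia.
Qed.

Lemma alpha_rel (a b : atom n) :
  arc_value alpha a * \prod_(x <- complement a b) arc_value alpha x =
  arc_value alpha b * \prod_(x <- complement b a) arc_value alpha x.
Proof.
apply: arc_value_rel.
- exact: alpha_shift.
- exact: alpha_triangle.
- exact: alpha_fan.
- exact: alpha_radius.
- exact: alpha_radius_flip.
- exact: alpha_disjoint.
- by move=> i j k l ij jk kl li; apply: alpha_nested => //; apply: ltnW.
- by move=> i j k ij jk ki; apply: alpha_nested.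
Qed.

End AnnularBraids.

(** * A rotation and half-twists from the braid generators *)

Section AnnularGenerators.
Variables (n : nat) (K : groupType) (y tm t0 t1 : K) (s : nat -> K).
Local Notation R := n.+1.
Hypothesis n_gt0 : 0 < n.
Hypothesis s_far : forall i j, 0 < i -> i.+1 < j -> j < n -> commute (s i) (s j).
Hypothesis s_braid : forall i, 0 < i -> i.+1 < n ->
  s i * s i.+1 * s i = s i.+1 * s i * s i.+1.
Hypothesis s_t0 : forall i, 0 < i -> i.+1 < n -> commute (s i) t0.
Hypothesis s_t0_braid : 1 < n -> s n.-1 * t0 * s n.-1 = t0 * s n.-1 * t0.
Hypothesis y_t0 : y * t0 = tm * y.
Hypothesis y_t1 : y * t1 = t0 * y.
Hypothesis t_dual : t1 * t0 = t0 * tm.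
Hypothesis y_s : forall i, 0 < i -> i < n -> commute y (s i).

Definition ann_A : K := sprod s 1 n.
Definition ann_rho : K := ann_A * t0 * y.
(** The value at 0 is forced: it is the conjugate of [t0], the value at n, by the rotation
    [ann_rho]. *)
Definition ann_sigma (i : nat) : K :=
  let k := i %% R in
  if k == 0 then t1 ^ ann_A^-1 else if k == n then t0 else s k.

Lemma ann_A_y : commute y ann_A.
Proof. by apply: commute_sprod => m mn; apply: y_s; lia. Qed.

Lemma ann_sigma0 : ann_sigma 0 = t1 ^ ann_A^-1.
Proof. by rewrite /ann_sigma mod0n. Qed.

Lemma ann_sigman : ann_sigma n = t0.
Proof. by rewrite /ann_sigma modn_small // eqxx gtn_eqF. Qed.

Lemma ann_sigma_s k : 0 < k < n -> ann_sigma k = s k.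
Proof.
move=> /andP[k0 kn]; rewrite /ann_sigma modn_small ?(gtn_eqF k0) ?(ltn_eqF kn) //.
exact: leqW.
Qed.

Lemma ann_sigma_period i : ann_sigma (i + R) = ann_sigma i.
Proof. by rewrite /ann_sigma modnDr. Qed.

Lemma ann_A_s k : 0 < k -> k.+1 < n -> ann_A * s k = s k.+1 * ann_A.
Proof.
move=> k0 kn; rewrite /ann_A (@sprod_cat _ s k 1) 1?(@sprod_cat _ s k.+2 k);
  try lia.
have -> : sprod s k k.+2 = s k * s k.+1.
  by rewrite (@sprod_cat _ s k.+1) // !sprod1.
have c1 : commute (s k) (sprod s k.+2 n).
  by apply: commute_sprod => m mn; apply: s_far; lia.
have c2 : commute (sprod s 1 k) (s k.+1).
  by apply/commute_sym/commute_sprod => m mn; apply/commute_sym/s_far; lia.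
rewrite -!mulgA -c1 (mulgA (s k.+1)) (mulgA (s k)) (mulgA (s k)) s_braid //.
by rewrite !mulgA c2.
Qed.

Lemma ann_A_t0_s k : 0 < k -> k.+1 < n ->
  ann_A * t0 * s k = s k.+1 * (ann_A * t0).
Proof. by move=> k0 kn; rewrite -mulgA -s_t0 // !mulgA ann_A_s. Qed.

Lemma ann_A_recr : 1 < n -> ann_A = sprod s 1 n.-1 * s n.-1.
Proof.
move=> n1; have <- : sprod s n.-1 n = s n.-1 by rewrite -{2}(prednK n_gt0) sprod1.
by rewrite /ann_A (@sprod_cat _ s n.-1) //; lia.
Qed.

Lemma ann_A_t0_last : 1 < n -> ann_A * t0 * s n.-1 = t0 * (ann_A * t0).
Proof.
move=> n1; rewrite (ann_A_recr n1).
rewrite -!(mulgA (sprod _ _ _)) s_t0_braid // !mulgA; congr (_ * _ * _).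
apply/commute_sym/commute_sprod => m mn; apply/commute_sym/s_t0; lia.
Qed.

Lemma ann_A_t0_sprod k : 0 < k < n ->
  ann_A * t0 * sprod s 1 k = sprod s 2 k.+1 * (ann_A * t0).
Proof.
elim: k => // k IHk kn; have [->|k0] := posnP k.
  by rewrite !sprod_nil mulg1 mul1g.
rewrite (@sprod_cat _ s k 1 k.+1) ?(@sprod_cat _ s k.+1 2 k.+2) ?sprod1; try lia.
rewrite mulgA IHk; last lia.
rewrite -mulgA ann_A_t0_s; [by rewrite mulgA|lia|lia].
Qed.

(** This is the relation between the rotation and the half-twist at 0, once [y] has been moved to
    the right and [ann_A] cleared. *)
Lemma ann_A_t0_twice :
  ann_A * t0 * (ann_A * t0) = ann_sigma 1 * (ann_A * t0 * ann_A).
Proof.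
have [n1|n1] := leqP n 1%N.
  have En : n = 1%N by lia.
  have -> : ann_sigma 1 = t0 by rewrite -[X in ann_sigma X]En ann_sigman.
  rewrite /ann_A En sprod_nil.
  by rewrite !mul1g mulg1.
rewrite ann_sigma_s; last lia.
rewrite {4}(ann_A_recr n1) [X in _ = s 1 * X]mulgA ann_A_t0_sprod; last lia.
rewrite (prednK n_gt0) -(mulgA (sprod s 2 n)) (ann_A_t0_last n1) !mulgA.
by rewrite -[s 1]sprod1 -sprod_cat.
Qed.

Lemma ann_rho_sigma i : ann_rho * ann_sigma i = ann_sigma i.+1 * ann_rho.
Proof.
have [k kR [-> ->]] : exists2 k, k < R &
    ann_sigma i = ann_sigma k /\ ann_sigma i.+1 = ann_sigma k.+1.
  exists (i %% R); first exact: ltn_pmod.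
  by rewrite /ann_sigma modn_mod -[(i %% R).+1]addn1 modnDml addn1.
have [->|k0] := posnP k.
  rewrite ann_sigma0 conjgE invgK /ann_rho; apply: (mulIg ann_A).
  rewrite !mulgA mulgVK -(mulgA _ y ann_A) -[in RHS](mulgA _ y ann_A) ann_A_y.
  rewrite !mulgA -(mulgA _ y t1) y_t1 !mulgA; congr (_ * _).
  by rewrite -!mulgA (mulgA ann_A) ann_A_t0_twice !mulgA.
have [kn|] := ltnP k.+1 n.
  rewrite !ann_sigma_s ?kn ?k0 //; last lia.
  by rewrite /ann_rho -mulgA (y_s k0 (ltnW kn)) mulgA ann_A_t0_s // !mulgA.
rewrite leq_eqVlt => /predU1P[En|nk].
  have n1 : 1 < n by lia.
  have Ek : k = n.-1 by lia.
  rewrite -En ann_sigman Ek ann_sigma_s; last lia.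
  rewrite /ann_rho -mulgA (_ : y * s n.-1 = s n.-1 * y); last by apply: y_s; lia.
  by rewrite mulgA ann_A_t0_last // !mulgA.
have -> : k = n by lia.
have -> : ann_sigma n.+1 = ann_sigma 0 by rewrite -(ann_sigma_period 0) add0n.
rewrite ann_sigman ann_sigma0 conjgE invgK /ann_rho.
rewrite -mulgA y_t0 -!mulgA mulKg; congr (_ * _).
by rewrite !mulgA t_dual.
Qed.

(** Relations are checked at 1, away from the conjugated generator at 0, and spread by conjugation
    with the rotation; periodicity recovers 0. *)
Lemma ann_sigma_ind (P : nat -> Prop) :
  (forall i, P (i + R) -> P i) -> (forall i, P i -> P i.+1) -> P 1%N ->
    forall i, P i.
Proof.
move=> per succ P1; have PS i : P i.+1 by elim: i => // i /succ.
by case=> // ; apply: per; rewrite add0n.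
Qed.

Lemma ann_braid : 1 < n -> forall i,
  ann_sigma i * ann_sigma i.+1 * ann_sigma i =
  ann_sigma i.+1 * ann_sigma i * ann_sigma i.+1.
Proof.
move=> n1; apply: ann_sigma_ind => [i|i E|].
- by rewrite -addSn !ann_sigma_period.
- apply: (mulIg ann_rho); rewrite -!mulgA -!ann_rho_sigma.
  rewrite !(mulgA (ann_sigma _) ann_rho) -!ann_rho_sigma -!(mulgA ann_rho).
  rewrite !(mulgA (ann_sigma _) ann_rho) -!ann_rho_sigma -!(mulgA ann_rho).
  by congr (_ * _); rewrite !mulgA.
- rewrite ann_sigma_s; last lia.
  have [n2|n2] := ltnP 2 n.
    by rewrite ann_sigma_s ?s_braid //; lia.
  have En : n = 2%N by lia.
  have -> : ann_sigma 2 = t0 by rewrite -[X in ann_sigma X]En ann_sigman.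
  by have := s_t0_braid n1; rewrite En.
Qed.

Lemma ann_far i j : i.+1 < j < i + n -> commute (ann_sigma i) (ann_sigma j).
Proof.
move=> ij; have [d Ed] : exists d, j = i + d by exists (j - i); lia.
subst j; have {ij}: 1 < d < n by lia.
move: i; apply: (ann_sigma_ind (P := fun i =>
  1 < d < n -> commute (ann_sigma i) (ann_sigma (i + d)))) => [i|i E dn|dn].
- by rewrite addnAC !ann_sigma_period.
- apply: (mulIg ann_rho); rewrite /commute -!mulgA addSn -!ann_rho_sigma.
  by rewrite !(mulgA (ann_sigma _) ann_rho) -!ann_rho_sigma -!(mulgA ann_rho) E.
- rewrite ann_sigma_s; last lia.
  have [E|ne] := eqVneq (1 + d) n.
    by rewrite E ann_sigman; apply: s_t0; lia.
  by rewrite ann_sigma_s ?add1n; [apply: s_far; lia|lia].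
Qed.

Lemma ann_sprod : sprod ann_sigma 1 R = ann_A * t0.
Proof.
rewrite (@sprod_cat _ _ n) // sprod1 ann_sigman; congr (_ * _).
by apply: eq_big_nat => m mn; rewrite ann_sigma_s.
Qed.

End AnnularGenerators.

(** * The extension of the braid group by a shift *)

Section IntegerPowers.
Variable G : groupType.
Implicit Types (x y : G) (k l : int).

Lemma expgzS x k : expgz x (k + 1)%R = expgz x k * x.
Proof.
case: k => [n|[|n]].
- by rewrite (_ : (Posz n + 1)%R = Posz n.+1) /= ?expgSr //; lia.
- by rewrite (_ : (Negz 0 + 1)%R = Posz 0) /= ?mulVg //; lia.
- rewrite (_ : (Negz n.+1 + 1)%R = Negz n) /=; last lia.
  by rewrite [x ^+ n.+2]expgS invgM mulgVK.
Qed.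

Lemma expgzD x k l : expgz x (k + l)%R = expgz x k * expgz x l.
Proof.
elim/int_rect: l => [|n IHn|n IHn].
- by rewrite GRing.addr0 mulg1.
- rewrite (_ : (k + n.+1%:Z)%R = ((k + n%:Z) + 1)%R); last lia.
  rewrite expgzS IHn (_ : n.+1%:Z%R = (n%:Z + 1)%R) ?expgzS ?mulgA //; lia.
- apply: (mulIg x); rewrite -mulgA -!expgzS.
  rewrite (_ : (k + - n.+1%:Z + 1)%R = (k + - n%:Z)%R); last lia.
  by rewrite (_ : (- n.+1%:Z + 1)%R = (- n%:Z)%R) ?IHn //; lia.
Qed.

Lemma expgzN x k : expgz x (- k)%R = (expgz x k)^-1.
Proof. by apply/esym/mulg1_eq; rewrite -expgzD GRing.addrN. Qed.

Lemma commute_expgz x y k : commute x y -> commute x (expgz y k).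
Proof.
by move=> xy; case: k => n; [apply: commuteX|apply/commuteV/commuteX].
Qed.

Lemma expgz_expgn x k n : expgz x k ^+ n = expgz (x ^+ n) k.
Proof. by case: k => m /=; rewrite ?expVgn expgnAC. Qed.

End IntegerPowers.

Lemma gmulfXz (G H : groupType) (f : UMagmaMorphism.type G H) x k :
  f (expgz x k) = expgz (f x) k.
Proof. by case: k => n; [apply: gmulfXn|apply: gmulfXVn]. Qed.

Section Shift.
Variables d e r : nat.
Local Notation G := (B d e r).
Local Notation z := (braid_z d e r).
Local Notation t := (braid_t d e r).
Local Notation s := (@braid_s d e r).

Lemma braid_s_comm i j : 2 <= `|label i - label j| -> commute (s i) (s j).
Proof.
move=> ij; have := pgen_rel (RelSS e ij).
by rewrite !big_cons !big_nil !mulg1.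
Qed.

Lemma braid_s_braid i j : label j = (label i).+1 ->
  s i * s j * s i = s j * s i * s j.
Proof.
move=> ij; have := pgen_rel (RelSSS e ij).
by rewrite !big_cons !big_nil !mulg1 !mulgA.
Qed.

Lemma braid_t_dual i j : t i * t (i - 1)%R = t j * t (j - 1)%R.
Proof.
by have := pgen_rel (RelTT e r i j); rewrite !big_cons !big_nil !mulg1.
Qed.

Lemma braid_st_braid i j : label j = 3 -> s j * t i * s j = t i * s j * t i.
Proof.
move=> j3; have := pgen_rel (RelSTS e i j3).
by rewrite !big_cons !big_nil !mulg1 !mulgA.
Qed.

Lemma braid_st_comm i j : 4 <= label j -> commute (s j) (t i).
Proof.
move=> j4; have := pgen_rel (RelST e i j4).
by rewrite !big_cons !big_nil !mulg1.
Qed.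

Lemma braid_zt i : z * t i = t (i - e%:Z)%R * z.
Proof.
by have := pgen_rel (RelZT e r i); rewrite !big_cons !big_nil !mulg1.
Qed.

Lemma braid_zs j : commute z (s j).
Proof.
by have := pgen_rel (RelZS e j); rewrite !big_cons !big_nil !mulg1.
Qed.

Lemma braid_rel_ind (K : groupType) (phi : braid_gen r -> K) :
  (forall i j, 2 <= `|label i - label j| ->
    commute (phi (GenS i)) (phi (GenS j))) ->
  (forall i j, label j = (label i).+1 ->
    phi (GenS i) * phi (GenS j) * phi (GenS i) =
    phi (GenS j) * phi (GenS i) * phi (GenS j)) ->
  (forall i j, phi (GenT i) * phi (GenT (i - 1)%R) =
    phi (GenT j) * phi (GenT (j - 1)%R)) ->
  (forall i j, label j = 3 -> phi (GenS j) * phi (GenT i) * phi (GenS j) =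
    phi (GenT i) * phi (GenS j) * phi (GenT i)) ->
  (forall i j, 4 <= label j -> commute (phi (GenS j)) (phi (GenT i))) ->
  (forall i, phi GenZ * phi (GenT i) = phi (GenT (i - e%:Z)%R) * phi GenZ) ->
  (forall j, commute (phi GenZ) (phi (GenS j))) ->
  forall u v, braid_rel e u v -> \prod_(x <- u) phi x = \prod_(x <- v) phi x.
Proof.
move=> ss sss tt sts st zt zs u v.
case=> [i j ij|i j ij|i j|i j j3|i j j4|i|j]; rewrite !big_cons !big_nil !mulg1.
- exact: ss.
- by rewrite !mulgA sss.
- exact: tt.
- by rewrite !mulgA sts.
- exact: st.
- exact: zt.
- exact: zs.
Qed.

Definition shift_gen (k : int) (x : braid_gen r) : G :=
  match x with
  | GenZ => z
  | GenT i => t (i - k)%R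
  | GenS j => s j
  end.

Lemma shift_gen_rel k u v : braid_rel e u v ->
  \prod_(x <- u) shift_gen k x = \prod_(x <- v) shift_gen k x.
Proof.
apply: braid_rel_ind => /=.
- exact: braid_s_comm.
- exact: braid_s_braid.
- move=> i j; rewrite !(GRing.addrAC _ (-1)%R (- k)%R).
  exact: braid_t_dual.
- by move=> i j; apply: braid_st_braid.
- by move=> i j; apply: braid_st_comm.
- by move=> i; rewrite braid_zt GRing.addrAC.
- exact: braid_zs.
Qed.

Definition bshift (k : int) : G -> G := presented_lift (shift_gen_rel k).
HB.instance Definition _ k := UMagmaMorphism.on (bshift k).

Lemma bshift_z k : bshift k z = z. Proof. exact: presented_lift_pgen. Qed.
Lemma bshift_t k i : bshift k (t i) = t (i - k)%R.
  Proof. exact: presented_lift_pgen. Qed.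
Lemma bshift_s k j : bshift k (s j) = s j. Proof. exact: presented_lift_pgen. Qed.

Lemma braid_ind (P : G -> Prop) :
  P 1 -> P z -> (forall i, P (t i)) -> (forall j, P (s j)) ->
  (forall x y, P x -> P y -> P (x * y)) -> (forall x, P x -> P x^-1) ->
  forall x, P x.
Proof.
by move=> P1 Pz Pt Ps PM PV; apply: presented_ind => // -[|i|j];
   [exact: Pz|exact: Pt|exact: Ps].
Qed.

Lemma bshiftD k l x : bshift (k + l)%R x = bshift k (bshift l x).
Proof.
elim/braid_ind: x => [||i|j|x y Ex Ey|x Ex].
- by rewrite !gmulf1.
- by rewrite !bshift_z.
- by rewrite !bshift_t; congr (t _); ring.
- by rewrite !bshift_s.
- by rewrite !gmulfM /= Ex Ey.
- by rewrite !gmulfV /= Ex.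
Qed.

Lemma bshift0 x : bshift 0 x = x.
Proof.
elim/braid_ind: x => [||i|j|x y Ex Ey|x Ex].
- by rewrite gmulf1.
- by rewrite bshift_z.
- by rewrite bshift_t GRing.subr0.
- by rewrite bshift_s.
- by rewrite gmulfM /= Ex Ey.
- by rewrite gmulfV /= Ex.
Qed.

(** The shift by [e] is thus inner, which lets [ext_zeta] commute with the copy of B(de, e, r) in
    the extension. *)
Lemma bshift_conj x : z * x = bshift e%:Z%R x * z.
Proof.
elim/braid_ind: x => [||i|j|x y Ex Ey|x Ex].
- by rewrite gmulf1 mulg1 mul1g.
- by rewrite bshift_z.
- by rewrite bshift_t braid_zt.
- by rewrite bshift_s; apply: braid_zs.
- by rewrite gmulfM /= mulgA Ex -!mulgA Ey.
- rewrite gmulfV /=; apply: (mulIg x); rewrite mulgVK.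
  by apply: (mulgI (bshift e%:Z%R x)); rewrite -Ex !mulgA mulgV mul1g Ex.
Qed.

(* The semidirect product of B(de, e, r) by Z, where 1 acts by                 *)
(* t_i |-> t_(i-1); up to the central element zeta = y ^ e z^-1, the generator *)
(* y of Z is an e-th root of z.                                                *)
Definition extension : Type := (G * int)%type.
HB.instance Definition _ := Choice.on extension.

Definition ext_one : extension := (1, 0%R).
Definition ext_mul (u v : extension) : extension :=
  (u.1 * bshift u.2 v.1, (u.2 + v.2)%R).
Definition ext_inv (u : extension) : extension :=
  (bshift (- u.2)%R u.1^-1, (- u.2)%R).

Lemma ext_mulA : associative ext_mul.
Proof.
by move=> u v x; rewrite /ext_mul /= gmulfM bshiftD mulgA GRing.addrA.
Qed.

Lemma ext_mul1 : left_id ext_one ext_mul.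
Proof. by case=> x k; rewrite /ext_mul /= bshift0 mul1g GRing.add0r. Qed.

Lemma ext_mulr1 : right_id ext_one ext_mul.
Proof. by case=> x k; rewrite /ext_mul /= gmulf1 mulg1 GRing.addr0. Qed.

Lemma ext_mulV : left_inverse ext_one ext_inv ext_mul.
Proof.
by case=> x k; rewrite /ext_mul /= -gmulfM mulVg gmulf1 GRing.addNr.
Qed.

Lemma ext_mulrV : right_inverse ext_one ext_inv ext_mul.
Proof.
case=> x k; rewrite /ext_mul /= -bshiftD GRing.addrN bshift0.
by rewrite mulgV.
Qed.

HB.instance Definition _ :=
  isGroup.Build extension ext_mulA ext_mul1 ext_mulr1 ext_mulV ext_mulrV.

Definition ext_in (x : G) : extension := (x, 0%R).

Lemma ext_inM : {morph ext_in : x y / x * y}.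
Proof.
move=> x y; rewrite [RHS]/(_ * _) /= /ext_mul /ext_in /=.
by rewrite bshift0.
Qed.

HB.instance Definition _ :=
  isUMagmaMorphism.Build G extension ext_in (erefl, ext_inM).

Definition ext_deg (u : extension) : int := u.2.
#[global] Arguments ext_deg : simpl never.

Lemma ext_degM u v : ext_deg (u * v) = (ext_deg u + ext_deg v)%R.
Proof. by []. Qed.

Lemma ext_degV u : ext_deg u^-1 = (- ext_deg u)%R.
Proof. by []. Qed.

Lemma ext_degX u m : ext_deg (u ^+ m) = (ext_deg u * m%:Z)%R.
Proof.
elim: m => [|m IHm]; first by rewrite GRing.mulr0.
by rewrite expgS ext_degM IHm intS GRing.mulrDr GRing.mulr1.
Qed.

Lemma ext_degXz u k : ext_deg (expgz u k) = (ext_deg u * k)%R.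
Proof.
case: k => m; rewrite /expgz ?ext_degV ext_degX //.
by rewrite NegzE GRing.mulrN.
Qed.

Definition ext_y : extension := (1, 1%R).
Definition ext_zeta : extension := (z^-1, e%:Z%R).

Lemma ext_deg_in x : ext_deg (ext_in x) = 0%R. Proof. by []. Qed.
Lemma ext_deg_y : ext_deg ext_y = 1%R. Proof. by []. Qed.
Lemma ext_deg_zeta : ext_deg ext_zeta = e%:Z%R. Proof. by []. Qed.

Lemma ext_yE x : ext_y * ext_in x = ext_in (bshift 1 x) * ext_y.
Proof.
rewrite [LHS]/(_ * _) [RHS]/(_ * _) /= /ext_mul /= bshift0.
by rewrite mul1g mulg1.
Qed.

Lemma ext_yX n : ext_y ^+ n = (1, n%:Z%R).
Proof.
elim: n => // n IHn; rewrite expgS IHn [LHS]/(_ * _) /= /ext_mul /=.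
by rewrite gmulf1 mulg1 -intS.
Qed.

Lemma ext_zetaC x : commute ext_zeta (ext_in x).
Proof.
rewrite /commute [LHS]/(_ * _) [RHS]/(_ * _) /= /ext_mul /=.
rewrite bshift0 GRing.addr0 GRing.add0r; congr (_, _).
by apply: (mulgI z); rewrite mulVKg mulgA bshift_conj mulgK.
Qed.

Lemma ext_z_zeta : ext_in z * ext_zeta = ext_y ^+ e.
Proof.
rewrite ext_yX [LHS]/(_ * _) /= /ext_mul /= bshift0 mulgV.
by rewrite GRing.add0r.
Qed.

End Shift.

(** * Comparison with the dual group *)

Section ToDual.
Variables d e n : nat.
Hypothesis n_gt0 : 0 < n.
Local Notation R := n.+1.
Local Notation G := (B d e R).
Local Notation z := (braid_z d e R).
Local Notation t := (braid_t d e R).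
Local Notation s := (@braid_s d e R).
Local Notation b := (ga n 0 R).
Local Notation tau := (ga n n R).

Lemma ga_shift i j : ga n (i + R) (j + R) = ga n i j.
Proof. exact: A_shift. Qed.

Lemma ga_braid i : 1 < n ->
  ga n i i.+1 * ga n i.+1 i.+2 * ga n i i.+1 =
  ga n i.+1 i.+2 * ga n i i.+1 * ga n i.+1 i.+2.
Proof.
move=> n1.
have T := @A_triangle _ _ _ (@ga_rel n) i i.+1 i.+2 ltac:(lia) ltac:(lia)
  ltac:(lia).
have F := @A_fan _ _ _ (@ga_rel n) i i.+1 i.+2 ltac:(lia) ltac:(lia) ltac:(lia).
by rewrite /ga T -mulgA F mulgA.
Qed.

Lemma ga_far i j : i.+1 < j -> j < i + n ->
  commute (ga n i i.+1) (ga n j j.+1).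
Proof. by move=> ij ji; apply: (A_disjoint (@ga_rel n)); lia. Qed.

Lemma b_far i : 0 < i -> i.+1 < R -> commute b (ga n i i.+1).
Proof. by move=> i0 iR; apply: (A_radius_arc (@ga_rel n)); lia. Qed.

(** A relation of type B_2: conjugation by [tau * b] exchanges the radii at 0 and at n, so its
    square commutes with [b]. It makes the images of t_i t_(i-1) independent of i. *)
Lemma b_tau : commute b (tau * tau ^ b^-1).
Proof.
pose bn := ga n n (n + R); pose t' := ga n R (n + R).
have bE : ga n R (R + R) = b by rewrite -(ga_shift 0 R).
have E1 : bn * tau = tau * b by rewrite -bE; apply: (A_radius (@ga_rel n)); lia.
have E2 : tau * b = b * t'.
  by rewrite -bE; apply: (A_radius_flip (@ga_rel n)); lia.
have E3 : t' * bn = b * t'.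
  have := @A_radius _ _ _ (@ga_rel n) R (n + R) ltac:(lia).
  by rewrite A_shift -bE.
pose X := tau * b.
have Xb : X * b = bn * X by rewrite /X -E1 -!mulgA -E1.
have Xbn : X * bn = b * X by rewrite /X E2 -mulgA E3.
have bXX : commute b (X * X).
  by rewrite /commute mulgA -Xbn -mulgA -Xb mulgA.
have -> : tau * tau ^ b^-1 = X * X * b^-1 * b^-1.
  by rewrite conjgE invgK /X !mulgA mulgK.
by apply: commuteM; [apply: commuteM => //|]; apply/commuteV/commute_refl.
Qed.

(** The indices of the s_j are reversed, so that s_3 goes to the neighbour of [tau] and the product
    A to an ascending chain. *)
Definition to_dual_gen (x : braid_gen R) : dual n :=
  match x with
  | GenZ => b ^+ e
  | GenT i => tau ^ expgz b i
  | GenS j => ga n (n.-1 - j) (n.-1 - j).+1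
  end.

Lemma label_lt (j : 'I_(R - 2)) : j < n.-1.
Proof. by have := ltn_ord j; lia. Qed.

Lemma conj_commute (K : groupType) (x y : K) : commute y x -> x ^ y = x.
Proof. by move=> yx; rewrite conjgE -yx mulKg. Qed.

Lemma to_dual_rel u v : braid_rel e u v ->
  \prod_(x <- u) to_dual_gen x = \prod_(x <- v) to_dual_gen x.
Proof.
apply: braid_rel_ind => /=.
- move=> i j; have := label_lt i; have := label_lt j; rewrite /label => lj li ij.
  have [lt|gt|E] := ltngtP i j.
  + by apply/commute_sym/ga_far; lia.
  + by apply: ga_far; lia.
  + lia.
- move=> i j; have := label_lt i; have := label_lt j; rewrite /label => lj li ij.
  rewrite (_ : n.-1 - i = (n.-1 - j).+1); last lia.
  by rewrite ga_braid //; lia.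
- move=> i j.
  have E k : tau ^ expgz b k * tau ^ expgz b (k - 1)%R = tau * tau ^ b^-1.
    have -> : expgz b (k - 1)%R = b^-1 * expgz b k.
      by rewrite GRing.addrC expgzD.
    rewrite conjgM -conjMg conj_commute //.
    exact/commute_sym/commute_expgz/commute_sym/b_tau.
  by rewrite !E.
- move=> i j j3; have lj := label_lt j;
    have j0 : (j : nat) = 0 by rewrite /label in j3; lia.
  have c : commute (expgz b i) (ga n n.-1 n.-1.+1).
    by apply/commute_sym/commute_expgz/commute_sym/b_far; lia.
  have := @ga_braid n.-1 ltac:(lia); rewrite j0 subn0 -(prednK n_gt0) /= => br.
  rewrite -(prednK n_gt0) /= in c; rewrite -(conj_commute c) -!conjMg.
  by rewrite br.
- move=> i j j4; have lj := label_lt j; rewrite /label in j4.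
  have c : commute (expgz b i) (ga n (n.-1 - j) (n.-1 - j).+1).
    by apply/commute_sym/commute_expgz/commute_sym/b_far; lia.
  rewrite /commute -(conj_commute c) -!conjMg; congr (_ ^ _).
  by apply: ga_far; lia.
- move=> i; rewrite !conjgE expgzD expgzN /= invgM invgK.
  by rewrite !mulgA mulgVK.
- move=> j; have lj := label_lt j.
  by apply/commute_sym/commuteX/commute_sym/b_far; lia.
Qed.

Definition to_dual : G -> dual n := presented_lift to_dual_rel.
HB.instance Definition _ := UMagmaMorphism.on to_dual.

Lemma to_dual_z : to_dual z = b ^+ e. Proof. exact: presented_lift_pgen. Qed.
Lemma to_dual_t i : to_dual (t i) = tau ^ expgz b i.
  Proof. exact: presented_lift_pgen. Qed.
Lemma to_dual_s j : to_dual (s j) = ga n (n.-1 - j) (n.-1 - j).+1.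
Proof. exact: presented_lift_pgen. Qed.

Local Notation gchain := (chain (cgen (@complement n))).

Lemma to_dual_A : to_dual (braid_A d e R) = gchain 1 n.
Proof.
transitivity (\prod_(i < R - 2) ga n i.+1 i.+2); last first.
  rewrite /chain big_add1 big_mkord /=.
  by have -> : (R - 2)%N = n.-1 by lia.
rewrite /braid_A gmulf_prod; apply: eq_bigr => i _ /=; rewrite to_dual_s /=.
have li := ltn_ord i.
by rewrite (_ : n.-1 - _ = i.+1)%N; last lia.
Qed.

Lemma cox_chain : cox n = gchain 1 R * b.
Proof.
rewrite cox_coxeter -(coxeterE (@ga_rel n) 1) /coxeter radius_chain //;
  last exact: ga_rel.
by rewrite add1n -/(ga n _ _) -(ga_shift 0 R).
Qed.

(** The factor A t_i goes to [X] conjugated by the i-th power of [b]; consecutive conjugators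
    telescope, leaving b^-e (X b)^e. *)
Lemma to_dual_lambda : to_dual (braid_lambda d e R) = cox n ^+ e.
Proof.
pose X := gchain 1 R; have cX : cox n = X * b := cox_chain.
have At i : to_dual (braid_A d e R * t i) = X ^ expgz b i.
  rewrite gmulfM /= to_dual_A to_dual_t /X chain_recr // conjMg -/(ga n n R).
  congr (_ * _); symmetry; apply: conj_commute.
  apply/commute_sym/commute_expgz/commute_sym/commute_chain => m mn.
  by apply: b_far; lia.
rewrite /braid_lambda gmulfM /= to_dual_z gmulf_prod /=.
rewrite (eq_bigr (fun k : 'I_e => X ^ expgz b (e%:Z - k%:Z)%R)) => [|k _];
  last exact: At.
suff -> : \prod_(k < e) X ^ expgz b (e%:Z - k%:Z)%R = (b ^+ e)^-1 * (X * b) ^+ e.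
  by rewrite mulVKg -cX.
elim: (e) => [|m IHm]; first by rewrite big_ord0 invg1 mulg1.
rewrite big_ord_recl (_ : (m.+1%:Z - (ord0 : 'I_m.+1)%:Z)%R = m.+1%:Z%R);
  last exact: GRing.subr0.
rewrite (eq_bigr (fun k : 'I_m => X ^ expgz b (m%:Z - k%:Z)%R)) => [|k _];
  last first.
  by congr (X ^ expgz b _); rewrite lift0; lia.
rewrite IHm conjgE /= -!mulgA; congr (_ * _).
rewrite [(X * b) ^+ m.+1]expgS -!mulgA; congr (X * _).
by rewrite (expgS b m) -mulgA mulVKg.
Qed.

End ToDual.

(** * From the dual group back to the extension *)

Section FromDual.
Variables d e n : nat.
Hypothesis n_gt0 : 0 < n.
Local Notation R := n.+1.
Local Notation G := (B d e R).
Local Notation z := (braid_z d e R).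
Local Notation t := (braid_t d e R).
Local Notation s := (@braid_s d e R).
Local Notation E := (extension d e R).
Local Notation inE := (@ext_in d e R).
Local Notation y := (ext_y d e R).
Local Notation zeta := (ext_zeta d e R).

(** Undoes the reversal of indices: for 0 < k < n this is the generator labelled n + 2 - k. Values
    at other k are irrelevant defaults. *)
Definition chain_s (k : nat) : G :=
  if insub (n.-1 - k) is Some j then s j else 1.

Lemma chain_sE k : 0 < k < n ->
  exists j : 'I_(R - 2), chain_s k = s j /\ (label j + k = n.-1 + 3)%N.
Proof.
move=> kn; rewrite /chain_s; case: insubP => [j _ /= jE|]; last by lia.
by exists j; rewrite /label; split=> //; lia.
Qed.

Local Notation S k := (inE (chain_s k)).
Local Notation T i := (inE (t i)).

Lemma ext_S_far i j : 0 < i -> i.+1 < j -> j < n -> commute (S i) (S j).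
Proof.
move=> i0 ij jn; have [i' [-> li]] := @chain_sE i ltac:(lia).
have [j' [-> lj]] := @chain_sE j ltac:(lia).
by apply/gmulf_commute/braid_s_comm; lia.
Qed.

Lemma ext_S_braid i : 0 < i -> i.+1 < n ->
  S i * S i.+1 * S i = S i.+1 * S i * S i.+1.
Proof.
move=> i0 iN; have [i' [-> li]] := @chain_sE i ltac:(lia).
have [j' [-> lj]] := @chain_sE i.+1 ltac:(lia).
by rewrite -!gmulfM /= (@braid_s_braid _ _ _ j' i') //; lia.
Qed.

Lemma ext_S_T i : 0 < i -> i.+1 < n -> commute (S i) (T 0).
Proof.
move=> i0 iN; have [i' [-> li]] := @chain_sE i ltac:(lia).
by apply/gmulf_commute/braid_st_comm; lia.
Qed.

Lemma ext_S_T_braid : 1 < n -> S n.-1 * T 0 * S n.-1 = T 0 * S n.-1 * T 0.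
Proof.
move=> n1; have [i' [-> li]] := @chain_sE n.-1 ltac:(lia).
by rewrite -!gmulfM /= braid_st_braid //; lia.
Qed.

Lemma ext_y_T i : y * T i = T (i - 1)%R * y.
Proof. by rewrite ext_yE bshift_t. Qed.

Lemma ext_T_dual : T 1 * T 0 = T 0 * T (-1).
Proof. by rewrite -!gmulfM; congr inE; exact: (braid_t_dual _ _ _ 1 0). Qed.

Lemma ext_y_S i : 0 < i -> i < n -> commute y (S i).
Proof.
move=> i0 iN; have [i' [-> li]] := @chain_sE i ltac:(lia).
by rewrite /commute ext_yE bshift_s.
Qed.

Local Notation rho := (ann_rho n y (T 0) (fun k => S k)).
Local Notation sigma := (ann_sigma n (T 0) (T 1) (fun k => S k)).
Local Notation al := (alpha n rho sigma).

Lemma ext_alpha_rel u v : crel (@complement n) u v ->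
  \prod_(x <- u) arc_value al x = \prod_(x <- v) arc_value al x.
Proof.
move=> [a [b [-> ->]]]; rewrite !big_cons; apply: alpha_rel.
- apply: (ann_rho_sigma n_gt0 ext_S_far ext_S_braid ext_S_T ext_S_T_braid
    (ext_y_T 0) (ext_y_T 1) ext_T_dual ext_y_S).
- exact: ann_sigma_period.
- move=> n1; apply: (ann_braid n_gt0 ext_S_far ext_S_braid ext_S_T ext_S_T_braid
    (ext_y_T 0) (ext_y_T 1) ext_T_dual ext_y_S n1).
- apply: (ann_far n_gt0 ext_S_far ext_S_braid ext_S_T ext_S_T_braid
    (ext_y_T 0) (ext_y_T 1) ext_T_dual ext_y_S).
Qed.

Definition from_dual : dual n -> E := presented_lift ext_alpha_rel.
HB.instance Definition _ := UMagmaMorphism.on from_dual.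

Lemma from_dual_ga i j : i < j <= i + R -> from_dual (ga n i j) = al i j.
Proof.
move=> ij; rewrite /from_dual presented_lift_pgen arc_valueE //.
by apply: alpha_shift; apply: ann_sigma_period.
Qed.

Lemma from_dual_step i : from_dual (ga n i i.+1) = sigma i.
Proof.
rewrite from_dual_ga; last lia.
by rewrite alpha_lt ?sprod_nil ?sprod1 ?invg1 ?mul1g //; lia.
Qed.

Lemma from_dual_b : from_dual (ga n 0 R) = y.
Proof.
rewrite from_dual_ga; last lia.
rewrite /alpha -[X in full _ _ _ X]add0n full_radius ann_sprod //.
by rewrite mulKg.
Qed.

Lemma ext_yXz k : expgz y k = (1, k).
Proof.
case: k => m /=; first exact: ext_yX.
by rewrite ext_yX [LHS]/(_^-1) /= /ext_inv /= invg1 gmulf1 NegzE.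
Qed.

Lemma ext_y_conj x k : (inE x) ^ expgz y k = inE (bshift (- k)%R x).
Proof.
rewrite ext_yXz conjgE; apply: (mulgI ((1, k) : E)); rewrite mulVKg.
rewrite [LHS]/(_ * _) [RHS]/(_ * _) /= /ext_mul /= bshift0.
by rewrite mulg1 mul1g -bshiftD GRing.addrN bshift0 GRing.add0r GRing.addr0.
Qed.

(** The t_i and s_j come back exactly, while z comes back as y ^ e, which is z times [zeta]; powers
    of [zeta] commute with the copy of the group and collect on the right. *)
Lemma from_to_dual u : exists k, from_dual (to_dual n_gt0 u) =
  inE u * expgz zeta k.
Proof.
elim/braid_ind: u => [||i|j|u v [k uk] [l vl]|u [k uk]].
- by exists 0%R; rewrite !gmulf1 mulg1.
- by exists 1%R; rewrite to_dual_z gmulfXn /= from_dual_b ext_z_zeta.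
- exists 0%R; rewrite to_dual_t gmulfJ gmulfXz /= from_dual_b from_dual_step.
  by rewrite mulg1 ann_sigman // ext_y_conj bshift_t GRing.sub0r GRing.opprK.
- exists 0%R; rewrite to_dual_s mulg1 from_dual_step.
  have lj := label_lt n_gt0 j.
  have [j' [jE lj']] := @chain_sE (n.-1 - j) ltac:(lia).
  rewrite ann_sigma_s ?jE; last lia.
  by congr (inE (s _)); apply: ord_inj; rewrite /label in lj'; lia.
- exists (k + l)%R; rewrite !gmulfM /= uk vl expgzD -!mulgA; congr (_ * _).
  rewrite !mulgA; congr (_ * _).
  exact/commute_sym/commute_sym/commute_sym/commute_expgz/commute_sym/ext_zetaC.
- exists (- k)%R; rewrite !gmulfV /= uk invgM expgzN.
  have c : commute (inE u)^-1 (expgz zeta k)^-1.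
    apply/commuteV/commute_expgz/commute_sym/commuteV/ext_zetaC.
  by rewrite -c.
Qed.

Lemma from_dual_cox : ext_deg (from_dual (cox n)) = 1%R.
Proof.
rewrite cox_chain gmulfM /= from_dual_b ext_degM ext_deg_y /chain gmulf_prod /=.
suff -> : ext_deg (\prod_(1 <= m < R) from_dual (ga n m m.+1)) = 0%R.
  by rewrite GRing.add0r.
rewrite big_nat; elim/big_rec: _ => // m x /andP[m0 mR] xd.
rewrite ext_degM xd from_dual_step GRing.addr0.
have [->|mn] := eqVneq m n; first by rewrite ann_sigman.
by rewrite ann_sigma_s //; lia.
Qed.

Lemma commute_arcs (x : dual n) : (forall i, commute x (ga n i i.+1)) ->
  forall i j, i < j < i + R -> commute x (ga n i j).
Proof.
move=> xs i j ij.
have xc k l : commute x (chain (cgen (@complement n)) k l).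
  by apply: commute_chain => m _; apply: xs.
have [k Ek] : exists k, j = (i + k).+1 by exists (j - i.+1); lia.
subst j; have := @chain_arcl _ _ _ (@ga_rel n) k i ltac:(lia).
move/(canRL (mulgK _)) => Ea; rewrite /ga Ea.
by apply: commuteM; [|apply: commuteV]; apply: xc.
Qed.

Local Notation F := (@to_dual d e n n_gt0).
Local Notation gchain := (chain (cgen (@complement n))).

Lemma to_dual_t1 : F (t 1) = ga n 0 n.
Proof.
rewrite to_dual_t /= conjgE; apply: (mulgI (ga n 0 R)); rewrite mulVKg.
have := @A_radius_flip _ _ _ (@ga_rel n) n R ltac:(lia).
have e1 : ga n R (R + R) = ga n 0 R := ga_shift _ 0 R.
have e2 : ga n R (n + R) = ga n 0 n := ga_shift _ 0 n.
by rewrite -!/(ga n _ _) e1 e2.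
Qed.

(** The images of the s_j and of t_0 are the short arcs other than (0, 1), which is obtained from
    t_1 and a chain. Short arcs generate all non-radial arcs, so [dual_center] applies. *)
Lemma to_dual_central u : central u -> exists p q, cox n ^+ p * F u = cox n ^+ q.
Proof.
move=> uC; apply: dual_center; apply: commute_arcs.
have fC v : commute (F u) (F v) by apply/gmulf_commute/uC.
have s_step k : 0 < k < n -> commute (F u) (ga n k k.+1).
  move=> kn; have jlt : n.-1 - k < R - 2 by lia.
  have := fC (s (Ordinal jlt)); rewrite to_dual_s /=.
  by rewrite (_ : n.-1 - (n.-1 - k) = k)%N //; lia.
have step0 : commute (F u) (ga n 0 1).
  have := @chain_arcr _ _ _ (@ga_rel n) n.-1 0 ltac:(lia).
  rewrite add0n (prednK n_gt0) (@chain_recl _ _ _ 0 n) //.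
  move/esym/(canRL (mulgK _)) => E0; rewrite /ga E0 -/(ga n 0 n) -to_dual_t1.
  have c : commute (F u) (gchain 1 n) by apply: commute_chain => m /s_step.
  by apply: commuteM; [apply: commuteM|apply: commuteV].
have step k : k < R -> commute (F u) (ga n k k.+1).
  move=> kR; have [->//|k0] := posnP k.
  have [->|kn] := eqVneq k n; last by apply: s_step; lia.
  by have := fC (t 0); rewrite to_dual_t /= conjg1.
move=> k; have := step (k %% R) (ltn_pmod k (ltn0Sn n)).
rewrite /ga -(arc_shift n (k %/ R)) addSn [(k %% R + _)%N]addnC.
by rewrite -divn_eq.
Qed.

(** The image is a power of the Coxeter element, whose degree is 1, so degree 0 leaves exponent
    0. *)
Lemma to_dual_central_deg0 u : central u ->
  ext_deg (from_dual (F u)) = 0%R -> F u = 1.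
Proof.
move=> /to_dual_central[p [q pq]] u0.
have := congr1 (fun x => ext_deg (from_dual x)) pq.
rewrite gmulfM !gmulfXn /= ext_degM !ext_degX from_dual_cox u0 => epq.
have Epq : p = q by lia.
by apply: (mulgI (cox n ^+ p)); rewrite pq Epq mulg1.
Qed.

Hypothesis e_gt0 : 0 < e.

Lemma to_dual_inj : injective (to_dual (d := d) (e := e) n_gt0).
Proof.
apply: gmulf_inj => u fu; have [k] := from_to_dual u.
rewrite fu gmulf1 => Eu.
have : ext_deg (inE u * expgz zeta k) = 0%R by rewrite -Eu.
rewrite ext_degM ext_degXz ext_deg_in ext_deg_zeta GRing.add0r => ek.
have k0 : k = 0%R by nia.
by move: Eu; rewrite k0 mulg1 => -[].
Qed.

Lemma braid_lambda_central : central (braid_lambda d e R ^+ R).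
Proof.
move=> u; apply: to_dual_inj; rewrite !gmulfM /= gmulfXn /= to_dual_lambda.
by rewrite -expgnA mulnC expgnA; apply/commute_sym/commuteX/coxR_central.
Qed.

End FromDual.

Lemma central_expgz (G : groupType) (x : G) k : central x -> central (expgz x k).
Proof. by move=> xC u; apply/commute_sym/commute_expgz/commute_sym. Qed.

Lemma central_expgn (G : groupType) (x : G) k : central x -> central (x ^+ k).
Proof. exact: (@central_expgz _ _ (Posz k)). Qed.

Lemma coxX_normal n q (a : atom n) :
  exists b, cox n ^+ q * cgen (@complement n) a =
    cgen (@complement n) b * cox n ^+ q.
Proof.
have [_ la <-] := arcP a; exists (arc n (lo a + q) (hi a + q)).
exact: coxX_conj.
Qed.

Lemma coxXV_normal n q (a : atom n) :
  exists b, cox n ^- q * cgen (@complement n) a =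
    cgen (@complement n) b * cox n ^- q.
Proof.
(* The inverse of rotation by q is rotation by q n, up to full turns. *)
have [_ la Ea] := arcP a; pose i := lo a + q * n; pose j := hi a + q * n.
exists (arc n i j); apply: (mulgI (cox n ^+ q)); rewrite mulVKg mulgA.
rewrite (coxX_conj q (i := i) (j := j)); last by rewrite /i /j; lia.
by rewrite mulgK /i /j -!addnA -!mulnSr /ga arc_shift Ea.
Qed.

(** * Roots of central elements and conjugacy in B(de, e, r) *)

Section Main.
Variables d e n : nat.
Hypotheses (n_gt0 : 0 < n) (e_gt0 : 0 < e).
Local Notation R := n.+1.
Local Notation G := (B d e R).
Local Notation lambda := (braid_lambda d e R).
Local Notation F := (@to_dual d e n n_gt0).
Local Notation P := (@from_dual d e n n_gt0).

Lemma conjugate_periodic (g : G) q : conjugate g (expgz lambda q) -> periodic g.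
Proof.
move=> [h ->]; exists (Posz R); split=> //= u.
have lC : central (expgz lambda q ^+ R).
  by rewrite expgz_expgn; apply/central_expgz/(braid_lambda_central n_gt0 e_gt0).
by rewrite -conjXg conj_commute //; apply/commute_sym/lC.
Qed.

Lemma deg_to_dual_lambda m : ext_deg (P (F (expgz lambda m))) = (e%:Z * m)%R.
Proof.
rewrite !gmulfXz /= to_dual_lambda gmulfXn /= ext_degXz ext_degX from_dual_cox.
by rewrite GRing.mul1r.
Qed.

(** With N = N0 R, the N-th powers of g and of lambda ^ m are both central and have equal degree, so
    their images coincide and roots of that image are conjugate. *)
Lemma periodic_root (g : G) N0 m : 0 < N0 -> central (g ^+ N0) ->
  ext_deg (P (F g)) = (e%:Z * m)%R -> exists X, F g = F (expgz lambda m) ^ X.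
Proof.
move=> N0_gt0 gC gm; pose N := (N0 * R)%N; set L := expgz lambda m.
have lC := braid_lambda_central (d := d) n_gt0 e_gt0.
have LN : central (L ^+ N).
  rewrite /L expgz_expgn; apply: central_expgz.
  by rewrite /N mulnC expgnA; apply: central_expgn.
have gN : central (g ^+ N) by rewrite /N expgnA; apply: central_expgn.
have gLN : F g ^+ N = F L ^+ N.
  apply: divg1_eq; rewrite -!gmulfXn -gmulfF.
  apply: to_dual_central_deg0.
    by move=> u; apply/commute_sym/commuteM; [|apply: commuteV];
      apply/commute_sym.
  have PX h : ext_deg (P (F (h ^+ N))) = (ext_deg (P (F h)) * N%:Z)%R.
    by rewrite !gmulfXn /= ext_degX.
  rewrite !gmulfM /= !gmulfV /= ext_degM ext_degV !PX gm deg_to_dual_lambda.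
  by rewrite GRing.addrN.
have FL : F L = expgz (cox n ^+ e) m by rewrite gmulfXz /= to_dual_lambda.
apply: (@dual_root_conjugate n N) => //; first by rewrite muln_gt0 N0_gt0.
- move=> a; rewrite FL; case: (m) => k /=; rewrite -expgnA.
    exact: coxX_normal.
  exact: coxXV_normal.
- move=> x; rewrite FL expgz_expgn; apply/commute_sym/commute_expgz.
  rewrite -expgnA /N mulnCA mulnA mulnC expgnA; apply: commuteX.
  exact: coxR_central.
Qed.

Lemma periodic_conjugate (g : G) : periodic g ->
  exists q, conjugate g (expgz lambda q).
Proof.
move=> [k [k0 kC]].
have [N0 [N0_gt0 gC]] : exists N0, 0 < N0 /\ central (g ^+ N0).
  case: k k0 kC => [[//|k]|k] _ kC; first by exists k.+1.
  exists k.+1; split=> // u.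
  by have := commuteV (commute_sym (kC u)); rewrite /= invgK => /commute_sym.
have [m gm] := from_to_dual n_gt0 g.
have gdeg : ext_deg (P (F g)) = (e%:Z * m)%R.
  by rewrite gm ext_degM ext_degXz ext_deg_in ext_deg_zeta GRing.add0r.
have [X gX] := periodic_root N0_gt0 gC gdeg.
exists m; set L := expgz lambda m in gX *.
have [X' [gX' degX']] : exists X', F g = F L ^ X' /\ ext_deg (P X') = 0%R.
  (* The correcting factor is a power of the Coxeter element, so it commutes with the image of
     lambda ^ m and does not change the conjugate. *)
  exists (expgz (cox n) (- ext_deg (P X))%R * X); split.
    rewrite conjgM gX; congr (_ ^ _); rewrite conj_commute //.
    apply/commute_sym/commute_expgz/commute_sym.
    rewrite /L gmulfXz /= to_dual_lambda.
    by apply/commute_expgz/commuteX/commute_refl.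
  rewrite gmulfM gmulfXz /= ext_degM ext_degXz from_dual_cox.
  by rewrite GRing.mul1r GRing.addNr.
have [x Ex] : exists x, P X' = ext_in x.
  by exists (P X').1; move: degX'; rewrite /ext_deg; case: (P X') => a b /= ->.
have [l Ll] := from_to_dual n_gt0 L.
have Ldeg := deg_to_dual_lambda m.
exists x.
(* Comparing degrees gives e l = e m; the two powers of [zeta] then agree and cancel from the
   conjugacy relation. *)
have El : l = m.
  move: Ldeg; rewrite -/L Ll ext_degM ext_degXz ext_deg_in ext_deg_zeta
    GRing.add0r.
  nia.
have := congr1 P gX'; rewrite gmulfJ /= Ex gm Ll El conjMg.
rewrite [X in _ = _ * X]conj_commute; last first.
  by apply: commute_expgz; apply/commute_sym/ext_zetaC.
by move/mulIg; rewrite -gmulfJ => -[].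
Qed.

End Main.

Local Close Scope group_scope.

Theorem theorem4p14 (d e r : nat) (hd : 2 <= d) (hr : 2 <= r) (he : 1 <= e)
    (g : B d e r) :
  periodic g <-> exists q : int, conjugate g (expgz (braid_lambda d e r) q).
Proof.
case: r hr g => [//|n] n_gt0 g; split.
  exact: (periodic_conjugate (n_gt0 : 0 < n) he).
by case=> q; apply: (conjugate_periodic (n_gt0 : 0 < n) he).
Qed.
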